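(* Consider either the Racah (R) or the $q$-Racah ($q$R) case, let $M\ge 1$, let $\mathcal D=\{d_1<d_2<\cdots<d_M\}$ be a set of $M$ positive integers, and let $n\in\mathbb Z_{\ge 0}$. Assume the parameters $(a,b,c,d)$ are generic (the case ''$a$ indeterminate''), or that $a=-N$ (R), $a=q^{-N}$ ($q$R) with $N$ a positive integer sufficiently large compared with $n$ (so that $n+M+1\le N$) and $b,c,d$ generic. Then the multi-indexed ($q$-)Racah polynomials $P_{\mathcal D,n}(\eta;\lambda)$ satisfy the $3+2M$ term recurrence relations with variable dependent coefficients (identities of polynomials in $\eta$) $$\sum_{k=-M-1}^{M+1}\mathcal C_{\mathcal D,n+k}(\lambda)\,R^{[M]}_{n,k}(\eta;\lambda)\,P_{\mathcal D,n+k}(\eta;\lambda)=0,$$ or equivalently $$\sum_{k=-M-1}^{M+1}\ \prod_{j=1}^M\frac{\mathcal E_{n+k}(\lambda)-\tilde{\mathcal E}_{d_j}(\lambda)}{\mathcal E_n(\lambda)-\tilde{\mathcal E}_{d_j}(\lambda)}\cdot R^{[M]}_{n,k}(\eta;\lambda)\,P_{\mathcal D,n+k}(\eta;\lambda)=0 ,$$ where $P_{\mathcal D,m}=0$ for $m<0$.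
   Context: Notation. Two parallel cases, Racah (R) and $q$-Racah ($q$R, with fixed $0<q<1$). $(z)_k$ and $(z;q)_k$ are the (q-)shifted factorials and $(z_1,\dots,z_r)_k=\prod_i (z_i)_k$, $(z_1,\dots,z_r;q)_k=\prod_i(z_i;q)_k$. Parameters: $\lambda=(a,b,c,d)$ (R), $q^{\lambda}=(a,b,c,d)$ ($q$R). With $\delta=(1,1,1,1)$, replacing $\lambda$ by $\lambda+\beta\delta$ means $(a,b,c,d)\to(a+\beta,b+\beta,c+\beta,d+\beta)$ (R), $(a,b,c,d)\to(aq^\beta,bq^\beta,cq^\beta,dq^\beta)$ ($q$R). ''Generic'' means outside a countable union of zero sets of nonzero polynomials in the parameters (in particular no denominator below vanishes). $\eta(x;\lambda)=x(x+d)$ (R), $(q^{-x}-1)(1-dq^x)$ ($q$R). $\tilde d=a+b+c-d-1$ (R), $abcd^{-1}q^{-1}$ ($q$R). ($q$-)Racah polynomials: $\check P_n(x;\lambda)=P_n(\eta(x;\lambda);\lambda)={}_4F_3\bigl(-n,n+\tilde d,-x,x+d;\,a,b,c;\,1\bigr)$ (R), ${}_4\phi_3\bigl(q^{-n},\tilde dq^n,q^{-x},dq^x;\,a,b,c;\,q;q\bigr)$ ($q$R); $P_n$ is a polynomial of degree $n$. Three-term coefficients: $\eta P_n=A_nP_{n+1}+B_nP_n+C_nP_{n-1}$ with $B_n=-A_n-C_n$ and R: $A_n=\frac{(n+a)(n+b)(n+c)(n+\tilde d)}{(2n+\tilde d)(2n+1+\tilde d)}$, $C_n=\frac{(n+\tilde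 d-a)(n+\tilde d-b)(n+\tilde d-c)n}{(2n-1+\tilde d)(2n+\tilde d)}$; $q$R: $A_n=\frac{(1-aq^n)(1-bq^n)(1-cq^n)(1-\tilde dq^n)}{(1-\tilde dq^{2n})(1-\tilde dq^{2n+1})}$, $C_n=d\,\frac{(1-a^{-1}\tilde dq^n)(1-b^{-1}\tilde dq^n)(1-c^{-1}\tilde dq^n)(1-q^n)}{(1-\tilde dq^{2n-1})(1-\tilde dq^{2n})}$. Energies: $\mathcal E_n=n(n+\tilde d)$ (R), $(q^{-n}-1)(1-\tilde dq^n)$ ($q$R). Virtual energies: $\tilde{\mathcal E}_{v}=-(c+v)(\tilde d-c-v)$ (R), $-(1-cq^{v})(1-c^{-1}\tilde dq^{-v})$ ($q$R). $\alpha=1$ (R), $abd^{-1}q^{-1}$ ($q$R). Twist: $\mathfrak t$ replaces $(a,b,c,d)$ by $(d-a+1,d-b+1,c,d)$ (R), $(dq/a,dq/b,c,d)$ ($q$R). $\check\xi_v(x;\lambda)=\check P_v(x;\mathfrak t(\lambda))$. $B'(x;\lambda)=-\frac{(x+d-a+1)(x+d-b+1)(x+c)(x+d)}{(2x+d)(2x+1+d)}$ (R), $-\frac{(1-a^{-1}dq^{x+1})(1-b^{-1}dq^{x+1})(1-cq^x)(1-dq^x)}{(1-dq^{2x})(1-dq^{2x+1})}$ ($q$R). $\varphi_m(x;\lambda)=\prod_{1\le j<k\le m}\frac{\eta(x+k-1;\lambda)-\eta(x+j-1;\lambda)}{\eta(k-j;\lambda)}$. Normalization constants: $\mathcal C_{\mathcal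 D}(\lambda)=\frac1{\varphi_M(0;\lambda)}\prod_{1\le j<k\le M}\frac{\tilde{\mathcal E}_{d_j}-\tilde{\mathcal E}_{d_k}}{\alpha B'(j-1;\lambda)}$, $\mathcal C_{\mathcal D,n}(\lambda)=(-1)^M\mathcal C_{\mathcal D}(\lambda)\frac{\varphi_M(0;\lambda)}{\varphi_{M+1}(0;\lambda)}\prod_{j=1}^M\frac{\mathcal E_n-\tilde{\mathcal E}_{d_j}}{\alpha B'(j-1;\lambda)}$. Multi-indexed polynomials: with $x_j=x+j-1$, $\check P_{\mathcal D,n}(x;\lambda)=P_{\mathcal D,n}(\eta(x;\lambda+M\delta);\lambda)=\mathcal C_{\mathcal D,n}(\lambda)^{-1}\varphi_{M+1}(x;\lambda)^{-1}\det\bigl(\check\xi_{d_1}(x_j),\dots,\check\xi_{d_M}(x_j),\,r_j(x_j)\check P_n(x_j)\bigr)_{1\le j\le M+1}$ (the $j$-th row is displayed), where $r_j(x_j)=\frac{(x+a,x+b)_{j-1}(x+d-a+j,x+d-b+j)_{M+1-j}}{(d-a+1,d-b+1)_M}$ (R), $r_j(x_j)=\frac{(aq^x,bq^x;q)_{j-1}(a^{-1}dq^{x+j},b^{-1}dq^{x+j};q)_{M+1-j}}{(abd^{-1}q^{-1})^{j-1}q^{Mx}(a^{-1}dq,b^{-1}dq;q)_M}$ ($q$R). $P_{\mathcal D,n}(\eta;\lambda)$ is a polynomial in $\eta$ of degree $\ell_{\mathcal D}+n$, $\ell_{\mathcal D}=\sum_jd_j-\frac12M(M-1)$, with $P_{\mathcal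 D,n}(0;\lambda)=1$; put $P_{\mathcal D,n}=0$ for $n<0$. Coefficients $R$: define $\check R^{[s]}_{n,k}(x)$ ($n,k\in\mathbb Z$, $s\ge-1$) by $\check R^{[s]}_{n,k}=0$ if $|k|>s+1$ or $n+k<0$; $\check R^{[-1]}_{n,0}=1$ for $n\ge0$; and for $s\ge0$ $\check R^{[s]}_{n,k}(x)=A_n\check R^{[s-1]}_{n+1,k-1}(x)+\bigl(B_n-\eta(x+s;\lambda)\bigr)\check R^{[s-1]}_{n,k}(x)+C_n\check R^{[s-1]}_{n-1,k+1}(x)$, with the convention $A_{-1}=0$ and $A_{-1}\times(\cdots)=0$ (so $\check R^{[s]}_{n,k}=0$ for $n<0$). $\check R^{[s]}_{n,k}(x)$ is a polynomial in $\eta(x;\lambda+s\delta)$, and $R^{[s]}_{n,k}(\eta;\lambda)$ denotes that polynomial: $\check R^{[s]}_{n,k}(x)=R^{[s]}_{n,k}(\eta(x;\lambda+s\delta);\lambda)$. *)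

(* Defs.v *)
From HB Require Import structures.
From mathcomp Require Import all_boot all_order all_algebra.
From mathcomp Require Import mpoly.
From Stdlib Require Import ClassicalEpsilon.

Set Implicit Arguments.
Unset Strict Implicit.
Unset Printing Implicit Defensive.

Import Order.TTheory GRing.Theory Num.Theory.
Local Open Scope ring_scope.

(* The scalars form an arbitrary numFieldType K, so that real as well as
   complex parameters are covered.  The two parallel cases are handled by one
   datatype; q is part of the case, and 0 < q < 1 is [valid_case]. *)
Variant racah_case (K : numFieldType) := Racah | QRacah of K.
Arguments Racah {K}.

Definition valid_case (K : numFieldType) (cs : racah_case K) : Prop :=
  match cs with Racah => True | QRacah q => 0 < q < 1 end.

(* (a, b, c, d): this is lambda for Racah and q^lambda for q-Racah. *)
Record params (K : numFieldType) :=
  Params { pa : K; pb : K; pc : K; pd : K }.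

(* A property of k parameters holds generically when it holds outside a
   countable union of zero sets of nonzero polynomials in the parameters. *)
Definition generic (K : numFieldType) (k : nat) (S : k.-tuple K -> Prop) :
    Prop :=
  exists F : nat -> {mpoly K[k]},
    (forall i, F i != 0) /\
    (forall v : k.-tuple K, (forall i, (F i).@[tnth v] != 0) -> S v).

Section RacahDefs.

Variables (K : numFieldType) (cs : racah_case K).
Implicit Types (l : params K) (u z : K).

(* (z)_k and (z; q)_k *)
Definition poch z (k : nat) : K :=
  match cs with
  | Racah => \prod_(i < k) (z + i%:R)
  | QRacah q => \prod_(i < k) (1 - z * q ^+ i)
  end.

Definition pochs (zs : seq K) (k : nat) : K := \prod_(z <- zs) poch z k.

(* The terminating series of upper parameters [up] (one of which is -n, resp.
   q^-n) and lower parameters [lo], at argument 1, resp. q.  Its terms vanish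
   beyond index n; summing up to n only matters when a lower parameter is
   -N, resp. q^-N. *)
Definition hyper (n : nat) (up lo : seq K) : K :=
  match cs with
  | Racah => \sum_(k < n.+1) pochs up k / pochs lo k * (k`!%:R)^-1
  | QRacah q => \sum_(k < n.+1) pochs up k / pochs lo k * q ^+ k / poch q k
  end.

(* The coordinate x is represented by u, where u = x for Racah and u = q^x
   (an arbitrary nonzero scalar) for q-Racah: the latter depends on x only
   through q^x. *)
Definition coord u : Prop :=
  match cs with Racah => True | QRacah _ => u != 0 end.

(* x + j *)
Definition cadd u (j : nat) : K :=
  match cs with Racah => u + j%:R | QRacah q => u * q ^+ j end.

(* x = j *)
Definition cnat (j : nat) : K :=
  match cs with Racah => j%:R | QRacah q => q ^+ j end.

(* lambda + m delta *)
Definition shift l (m : nat) : params K :=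
  let: Params a b c d := l in
  match cs with
  | Racah => Params (a + m%:R) (b + m%:R) (c + m%:R) (d + m%:R)
  | QRacah q => Params (a * q ^+ m) (b * q ^+ m) (c * q ^+ m) (d * q ^+ m)
  end.

(* The twist t(lambda) *)
Definition twist l : params K :=
  let: Params a b c d := l in
  match cs with
  | Racah => Params (d - a + 1) (d - b + 1) c d
  | QRacah q => Params (d * q / a) (d * q / b) c d
  end.

Definition eta l u : K :=
  let: Params a b c d := l in
  match cs with
  | Racah => u * (u + d)
  | QRacah _ => (u^-1 - 1) * (1 - d * u)
  end.

Definition dtilde l : K :=
  let: Params a b c d := l in
  match cs with
  | Racah => a + b + c - d - 1
  | QRacah q => a * b * c * d^-1 * q^-1
  end.

(* The (q-)Racah polynomial \check P_n(x; lambda) *)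
Definition Pcheck l (n : nat) u : K :=
  let: Params a b c d := l in let dt := dtilde l in
  match cs with
  | Racah => hyper n [:: - n%:R; n%:R + dt; - u; u + d] [:: a; b; c]
  | QRacah q => hyper n [:: q ^- n; dt * q ^+ n; u^-1; d * u] [:: a; b; c]
  end.

Definition coefA l (n : int) : K :=
  let: Params a b c d := l in let dt := dtilde l in
  if n == -1 then 0 else
  match cs with
  | Racah =>
      (n%:~R + a) * (n%:~R + b) * (n%:~R + c) * (n%:~R + dt)
      / ((2 * n%:~R + dt) * (2 * n%:~R + 1 + dt))
  | QRacah q =>
      (1 - a * q ^ n) * (1 - b * q ^ n) * (1 - c * q ^ n) * (1 - dt * q ^ n)
      / ((1 - dt * q ^ (2 * n)) * (1 - dt * q ^ (2 * n + 1)))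
  end.

Definition coefC l (n : int) : K :=
  let: Params a b c d := l in let dt := dtilde l in
  match cs with
  | Racah =>
      (n%:~R + dt - a) * (n%:~R + dt - b) * (n%:~R + dt - c) * n%:~R
      / ((2 * n%:~R - 1 + dt) * (2 * n%:~R + dt))
  | QRacah q =>
      d * ((1 - a^-1 * dt * q ^ n) * (1 - b^-1 * dt * q ^ n)
           * (1 - c^-1 * dt * q ^ n) * (1 - q ^ n)
           / ((1 - dt * q ^ (2 * n - 1)) * (1 - dt * q ^ (2 * n))))
  end.

Definition coefB l (n : int) : K := - coefA l n - coefC l n.

Definition energy l (n : int) : K :=
  let dt := dtilde l in
  match cs with
  | Racah => n%:~R * (n%:~R + dt)
  | QRacah q => (q ^ (- n) - 1) * (1 - dt * q ^ n)
  end.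

Definition venergy l (v : nat) : K :=
  let: Params a b c d := l in let dt := dtilde l in
  match cs with
  | Racah => - ((c + v%:R) * (dt - c - v%:R))
  | QRacah q => - ((1 - c * q ^+ v) * (1 - c^-1 * dt * q ^- v))
  end.

Definition alpha l : K :=
  let: Params a b c d := l in
  match cs with Racah => 1 | QRacah q => a * b * d^-1 * q^-1 end.

Definition Bprime l u : K :=
  let: Params a b c d := l in
  match cs with
  | Racah =>
      - ((u + d - a + 1) * (u + d - b + 1) * (u + c) * (u + d)
         / ((2 * u + d) * (2 * u + 1 + d)))
  | QRacah q =>
      - ((1 - a^-1 * d * (u * q)) * (1 - b^-1 * d * (u * q))
         * (1 - c * u) * (1 - d * u)
         / ((1 - d * u ^+ 2) * (1 - d * (u ^+ 2 * q))))
  end.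

(* Indices j < k start from 0 here, as everywhere below. *)
Definition phi l (m : nat) u : K :=
  \prod_(k < m) \prod_(j < k)
    ((eta l (cadd u k) - eta l (cadd u j)) / eta l (cnat (k - j))).

Definition normCD l (M : nat) (D : M.-tuple nat) : K :=
  (phi l M (cnat 0))^-1
  * \prod_(k < M) \prod_(j < M | (j < k)%N)
      ((venergy l (tnth D j) - venergy l (tnth D k))
       / (alpha l * Bprime l (cnat j))).

Definition normCDn l (M : nat) (D : M.-tuple nat) (n : int) : K :=
  (-1) ^+ M * normCD l D * (phi l M (cnat 0) / phi l M.+1 (cnat 0))
  * \prod_(j < M)
      ((energy l n - venergy l (tnth D j)) / (alpha l * Bprime l (cnat j))).

(* The factor r_{i+1}(x + i); here u stands for x, not for x + i. *)
Definition rfactor l (M i : nat) u : K :=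
  let: Params a b c d := l in
  match cs with
  | Racah =>
      pochs [:: u + a; u + b] i
      * pochs [:: u + d - a + i.+1%:R; u + d - b + i.+1%:R] (M - i)
      / pochs [:: d - a + 1; d - b + 1] M
  | QRacah q =>
      pochs [:: a * u; b * u] i
      * pochs [:: a^-1 * d * (u * q ^+ i.+1); b^-1 * d * (u * q ^+ i.+1)]
          (M - i)
      / ((a * b * d^-1 * q^-1) ^+ i * u ^+ M
         * pochs [:: a^-1 * d * q; b^-1 * d * q] M)
  end.

(* \check P_{D,n}(x; lambda), meaningful where phi_{M+1}(x; lambda) != 0 *)
Definition PDcheck l (M : nat) (D : M.-tuple nat) (n : nat) u : K :=
  (normCDn l D n%:Z)^-1 * (phi l M.+1 u)^-1
  * \det (\matrix_(i < M.+1, j < M.+1)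
      if (j < M)%N then Pcheck (twist l) (nth 0%N D j) (cadd u i)
      else rfactor l M i u * Pcheck l n (cadd u i)).

(* The polynomial p such that p(eta(x; l)) = f(x) for all x in dom.  It is
   unique for the domains used below; were there none, it would be left
   unspecified by epsilon. *)
Definition poly_in_eta l (dom : K -> Prop) (f : K -> K) : {poly K} :=
  epsilon (inhabits 0) (fun p => forall u, dom u -> p.[eta l u] = f u).

(* P_{D,m}(eta; lambda), with P_{D,m} = 0 for m < 0 *)
Definition PD l (M : nat) (D : M.-tuple nat) (m : int) : {poly K} :=
  match m with
  | Posz n => poly_in_eta (shift l M)
                (fun u => coord u /\ phi l M.+1 u != 0) (PDcheck l D n)
  | Negz _ => 0
  end.

(* [Rcheck l t n k] is \check R^{[s]}_{n,k} with t = s + 1. *)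
Fixpoint Rcheck l (t : nat) (n k : int) u : K :=
  if (t%:Z < `|k|) || (n + k < 0) then 0 else
  match t with
  | 0 => 1
  | s.+1 =>
      coefA l n * Rcheck l s (n + 1) (k - 1) u
      + (coefB l n - eta l (cadd u s)) * Rcheck l s n k u
      + coefC l n * Rcheck l s (n - 1) (k + 1) u
  end.

(* R^{[s]}_{n,k}(eta; lambda) *)
Definition Rpoly l (s : nat) (n k : int) : {poly K} :=
  poly_in_eta (shift l s) coord (Rcheck l s.+1 n k).

(* The 3+2M term recurrence relations, in the two equivalent forms; the
   summation index is k = i - (M + 1), from -M-1 to M+1. *)
Definition recurrence_norm l (M : nat) (D : M.-tuple nat) (n : nat) : Prop :=
  \sum_(i < (2 * M + 3)%N)
    (let k : int := i%:Z - M.+1%:Z in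
     normCDn l D (n%:Z + k) *: (Rpoly l M n%:Z k * PD l D (n%:Z + k))) = 0.

Definition recurrence_energy l (M : nat) (D : M.-tuple nat) (n : nat) : Prop :=
  \sum_(i < (2 * M + 3)%N)
    (let k : int := i%:Z - M.+1%:Z in
     (\prod_(j < M) ((energy l (n%:Z + k) - venergy l (tnth D j))
                     / (energy l n%:Z - venergy l (tnth D j))))
     *: (Rpoly l M n%:Z k * PD l D (n%:Z + k))) = 0.

(* a = -N, resp. a = q^-N *)
Definition trunc_a (N : nat) : K :=
  match cs with Racah => - N%:R | QRacah q => q ^- N end.

End RacahDefs.

(* Main.v *)
(** The recursion defining R^{[M]} says that the sum of R^{[M]}_{n,k}(x) P_{n+k}(y)
    over k is P_n(y) times the product of the eta(y) - eta(x+i), 0 <= i <= M;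
    this follows by induction from the three-term recurrence of the
    (q-)Racah polynomials.  At y = x+j, 0 <= j <= M, the product vanishes.
    Since P_{D,n} is, up to a factor independent of n and C_{D,n}, a determinant
    which is linear in the last column (r_j(x_j) P_n(x_j))_j, the recurrence
    relation holds at every x where that factor is finite, hence identically.

    It must also be shown that P_{D,n} and R^{[M]}_{n,k} are polynomials in
    eta(x; lambda + M delta), i.e. (Laurent) polynomials invariant under the
    reflection x -> -x-d-M.  The reflection reverses the rows of the
    determinant and the factors of the product of commuting operators that
    defines R.  The factors eta(x+k) - eta(x+j) of phi_{M+1} depend, up to
    units, only on s = j + k; for fixed s, subtracting row j from row k for all
    such pairs extracts them from the determinant, and the factors for
    different s are coprime. *)
Require Import Defs.
From mathcomp Require Import all_boot all_order all_algebra.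
From mathcomp Require Import perm mpoly ring zify.
From Stdlib Require Import ClassicalEpsilon.
(* Defs again: coord and coefC are also names of the libraries. *)
Require Import Defs.

Set Implicit Arguments.
Unset Strict Implicit.
Unset Printing Implicit Defensive.

Import Order.TTheory GRing.Theory Num.Theory.
Local Open Scope ring_scope.

(** * Two determinant and product identities *)

(** [PD] and [Rpoly] are picked by [epsilon], so nothing is known of them until a polynomial with
    the prescribed values has been exhibited. This is why divisibility and symmetry come before any
    evaluation. Even then [PD] can be evaluated only where phi_{M+1} does not vanish. The final
    identity is therefore checked at x = 0, 1, 2, ..., which generically are such points and give
    infinitely many values of eta.

    The truncated case fixes the ranges. For a = -N, resp. q^-N, the coefficient 1/(a)_k is finite
    only for k <= N, and the three-term recurrence of P_n is available only for n < N. The argument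
    uses it for indices up to n + M, whence n + M + 1 <= N. *)

(** Subtracting row [f i] from row [i], for all [i] in [P] at once, is left multiplication by a
    lower unitriangular matrix, because [f i < i]. *)
Lemma det_fold (R : comNzRingType) (n : nat) (A B : 'M[R]_n) (P : pred 'I_n)
    (f : 'I_n -> 'I_n) (x : R) :
  (forall i, P i -> (f i < i)%N) ->
  (forall i c, P i -> A i c - A (f i) c = x * B i c) ->
  (forall i c, ~~ P i -> A i c = B i c) ->
  \det A = x ^+ #|P| * \det B.
Proof.
move=> ltf AP AN.
pose E : 'M[R]_n := \matrix_(i, j) ((i == j)%:R - (P i && (j == f i))%:R).
pose G : 'rV[R]_n := \row_i (if P i then x else 1).
have detE : \det E = 1.
  rewrite det_trig.
    apply: big1 => i _; rewrite mxE eqxx.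
    case Pi : (P i); last by rewrite subr0.
    rewrite /= (_ : i == f i = false) ?subr0 //.
    by apply/negP => /eqP/(congr1 val) /= e; have := ltf i Pi; rewrite -e ltnn.
  apply/is_trig_mxP => i j lij; rewrite mxE.
  rewrite (_ : i == j = false); last by rewrite -val_eqE /= ltn_eqF.
  case Pi : (P i); rewrite ?subrr //=.
  rewrite (_ : j == f i = false) ?subrr //.
  apply/negP => /eqP e; have := ltf i Pi.
  by rewrite -e ltnNge (ltnW lij).
have EA : E *m A = diag_mx G *m B.
  apply/matrixP => i c; rewrite mul_diag_mx !mxE.
  under eq_bigr do rewrite mxE mulrBl.
  rewrite sumrB (bigD1 i) //= eqxx mul1r big1 ?addr0; last first.
    by move=> j /negPf ji; rewrite eq_sym ji mul0r.
  case Pi : (P i) => /=.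
    rewrite (bigD1 (f i)) //= eqxx mul1r big1 ?addr0 ?AP //.
    by move=> j /negPf ji; rewrite ji mul0r.
  rewrite big1 ?subr0 ?mul1r ?AN ?Pi // => j _; by rewrite mul0r.
have /(congr1 (fun M => \det M)) := EA.
rewrite !det_mulmx detE mul1r det_diag => ->; congr (_ * _).
under eq_bigr do rewrite mxE.
by rewrite -big_mkcond /= prodr_const.
Qed.

(* The pairs [j < k] are sorted according to [s = j + k]. *)
Lemma prod_pairs (R : comNzRingType) (M : nat) (F : nat -> R) :
  \prod_(k < M.+1) \prod_(j < k) F (j + k)%N
  = \prod_(s < (M + M).+1) F s ^+ #|[pred i : 'I_M.+1 | (i <= s < i + i)%N]|.
Proof.
under [RHS]eq_bigr do rewrite -prodr_const.
rewrite (exchange_big_dep predT) //=; apply: eq_bigr => k _.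
transitivity (\prod_(k <= s < k + k) F s).
  rewrite -[X in _ = \big[_/_]_(X <= _ < _) _]add0n.
  by rewrite big_addn addnK big_mkord.
rewrite (big_nat_widen _ _ (M + M).+1); last first.
  by rewrite leqW // leq_add // -ltnS.
by rewrite (big_nat_widenl _ 0) // big_mkord; apply: eq_bigl => s; rewrite inE andbC.
Qed.

Lemma poly_vanish (K : numFieldType) (p : {poly K}) :
  (forall u, p.[u] = 0) -> p = 0.
Proof.
move=> p0; apply/eqP; case: (boolP (p == 0)) => // pn0.
have := @max_poly_roots K p [seq i%:R | i <- iota 0 (size p)] pn0.
rewrite size_map size_iota ltnn => -> //.
  by apply/allP => x _; rewrite rootE p0.
rewrite map_inj_uniq ?iota_uniq // => i j /eqP.
by rewrite eqr_nat => /eqP.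
Qed.

(** * Regular functions *)

(* Regular functions of the coordinate: polynomials in x, resp. Laurent
   polynomials in q^x. *)
Section Regular.

Variables (K : numFieldType) (cs : racah_case K).
Implicit Types (f g h : K -> K) (u D : K) (p Z : {poly K}).

(** Its zeros are exactly the scalars that are not coordinates. An identity on coordinates, once
    multiplied by [weight], thus holds at every scalar, as [poly_vanish] demands. *)
Definition weight : {poly K} := if cs is QRacah _ then 'X else 1.

Definition regular f :=
  exists p m, forall u, coord cs u -> f u = p.[u] / weight.[u] ^+ m.

Definition eq_coord f g := forall u, coord cs u -> f u = g u.

Lemma weight_neq0 u : coord cs u -> weight.[u] != 0.
Proof. by rewrite /weight; case: cs => [|q] /=; rewrite ?hornerC ?oner_eq0 ?hornerX. Qed.

Lemma weight_poly_neq0 : weight != 0.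
Proof. by rewrite /weight; case: cs => [|q]; rewrite ?oner_eq0 ?polyX_eq0. Qed.

Lemma coordNweight u : ~ coord cs u -> weight.[u] = 0.
Proof.
rewrite /weight; case: cs => [|q] //= /negP; rewrite negbK hornerX.
by move/eqP.
Qed.

Lemma coord_dec u : coord cs u \/ ~ coord cs u.
Proof. by case: cs => [|q] /=; [left | case: (u =P 0); [right | left]]. Qed.

Lemma reg_ext f g : eq_coord g f -> regular f -> regular g.
Proof. by move=> gf [p [m fE]]; exists p, m => u cu; rewrite gf ?fE. Qed.

Lemma reg_poly p : regular (horner p).
Proof. by exists p, 0%N => u _; rewrite expr0 divr1. Qed.

Lemma reg_cst (c : K) : regular (fun _ => c).
Proof. by apply: reg_ext (reg_poly c%:P) => u _; rewrite hornerC. Qed.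

Lemma reg_id : regular id.
Proof. by apply: reg_ext (reg_poly 'X) => u _; rewrite hornerX. Qed.

Lemma regD f g : regular f -> regular g -> regular (fun u => f u + g u).
Proof.
move=> [p [m fE]] [r [k gE]]; exists (p * weight ^+ k + r * weight ^+ m), (m + k)%N%N.
move=> u cu; rewrite fE ?gE // hornerD !hornerM !horner_exp exprD.
by have := weight_neq0 cu; set w := weight.[u] => wn0; field; rewrite !expf_neq0.
Qed.

Lemma regM f g : regular f -> regular g -> regular (fun u => f u * g u).
Proof.
move=> [p [m fE]] [r [k gE]]; exists (p * r), (m + k)%N.
by move=> u cu; rewrite fE ?gE // hornerM exprD invfM mulrACA.
Qed.

Lemma regN f : regular f -> regular (fun u => - f u).
Proof.
by move=> /(regM (reg_cst (-1))); apply: reg_ext => u _; rewrite mulN1r.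
Qed.

Lemma regB f g : regular f -> regular g -> regular (fun u => f u - g u).
Proof. by move=> rf /regN; apply: regD. Qed.

Lemma regX f k : regular f -> regular (fun u => f u ^+ k).
Proof.
move=> rf; elim: k => [|k IHk]; first exact: reg_cst.
by apply: reg_ext (regM rf IHk) => u _; rewrite exprS.
Qed.

Lemma reg_sum (I : Type) (r : seq I) (P : pred I) (F : I -> K -> K) :
  (forall i, P i -> regular (F i)) ->
  regular (fun u => \sum_(i <- r | P i) F i u).
Proof.
move=> rF; elim: r => [|i r IHr].
  by apply: reg_ext (reg_cst 0) => u _; rewrite big_nil.
case Pi : (P i); last by apply: reg_ext IHr => u _; rewrite big_cons Pi.
by apply: reg_ext (regD (rF i Pi) IHr) => u _; rewrite big_cons Pi.
Qed.

Lemma reg_prod (I : Type) (r : seq I) (P : pred I) (F : I -> K -> K) :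
  (forall i, P i -> regular (F i)) ->
  regular (fun u => \prod_(i <- r | P i) F i u).
Proof.
move=> rF; elim: r => [|i r IHr].
  by apply: reg_ext (reg_cst 1) => u _; rewrite big_nil.
case Pi : (P i); last by apply: reg_ext IHr => u _; rewrite big_cons Pi.
by apply: reg_ext (regM (rF i Pi) IHr) => u _; rewrite big_cons Pi.
Qed.

Lemma reg_horner p f : regular f -> regular (fun u => p.[f u]).
Proof.
move=> rf; elim/poly_ind: p => [|p c IHp].
  by apply: reg_ext (reg_cst 0) => u _; rewrite horner0.
apply: reg_ext (regD (regM IHp rf) (reg_cst c)) => u _.
by rewrite hornerMXaddC.
Qed.

Lemma reg_det n (A : K -> 'M[K]_n) :
  (forall i j, regular (fun u => A u i j)) -> regular (fun u => \det (A u)).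
Proof.
move=> rA; apply: reg_sum => s _; apply: regM; first exact: reg_cst.
by apply: reg_prod => i _; apply: rA.
Qed.

Lemma reg_comp f g : (forall u, coord cs u -> coord cs (g u)) ->
  regular g -> regular (fun u => (weight.[g u])^-1) -> regular f ->
  regular (fun u => f (g u)).
Proof.
move=> cg rg rw [p [m fE]].
apply: reg_ext (regM (reg_horner p rg) (regX m rw)) => u cu.
by rewrite fE ?exprVn //; apply: cg.
Qed.

(** A density argument: the cross-multiplied identity, times [weight] and [Z], vanishes at all
    scalars, and the nonzero polynomials cancel. *)
Lemma reg_eq f g Z : Z != 0 -> regular f -> regular g ->
  (forall u, coord cs u -> Z.[u] != 0 -> f u = g u) -> eq_coord f g.
Proof.
move=> Zn0 [p [m fE]] [r [k gE]] fg.
have /eqP : (p * weight ^+ k - r * weight ^+ m) * weight * Z = 0.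
  apply: poly_vanish => u; rewrite !hornerE.
  case: (coord_dec u) => [cu|/coordNweight ->]; last by ring.
  have wn0 := weight_neq0 cu.
  case: (eqVneq Z.[u] 0) => [-> | Zu]; first by rewrite mulr0.
  have := fg u cu Zu; rewrite fE ?gE // => /eqP.
  rewrite eqr_div ?expf_neq0 // => /eqP ->; by rewrite subrr !mul0r.
rewrite !mulf_eq0 (negPf Zn0) (negPf weight_poly_neq0) !orbF subr_eq0 => /eqP e.
move=> u cu; rewrite fE ?gE //; apply/eqP.
rewrite eqr_div ?expf_neq0 ?weight_neq0 //.
by rewrite -!horner_exp -!hornerM e.
Qed.

(** Divisibility is moved to the numerator of [f]: a factor coprime to [weight] cannot be absorbed
    by the denominators, and pairwise coprime powers that divide a polynomial divide it jointly. *)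
Lemma reg_dvd (n : nat) (L : nat -> {poly K}) (e : nat -> nat) f :
  (forall s, coprimep (L s) weight) ->
  (forall s t, s != t -> coprimep (L s) (L t)) ->
  regular f ->
  (forall s, (s < n)%N ->
     exists2 g, regular g & eq_coord f (fun u => (L s).[u] ^+ e s * g u)) ->
  exists2 g, regular g &
    eq_coord f (fun u => \prod_(s < n) (L s).[u] ^+ e s * g u).
Proof.
move=> cw cL [p [m fE]] dvd.
have dvdp1 s : (s < n)%N -> L s ^+ e s %| p.
  move=> /dvd [g [r [k gE]] fg].
  have dk : p * weight ^+ k = (L s ^+ e s * r) * weight ^+ m.
    apply/eqP; rewrite -subr_eq0; apply/eqP.
    have /eqP : (p * weight ^+ k - (L s ^+ e s * r) * weight ^+ m) * weight = 0.
      apply: poly_vanish => u; rewrite !hornerE.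
      case: (coord_dec u) => [cu|/coordNweight ->]; last by ring.
      have wn0 := weight_neq0 cu.
      have := fg u cu; rewrite fE ?gE // mulrA => /eqP.
      by rewrite eqr_div ?expf_neq0 // => /eqP ->; rewrite subrr !mul0r.
    by rewrite mulf_eq0 (negPf weight_poly_neq0) orbF => /eqP.
  have : L s ^+ e s %| p * weight ^+ k by rewrite dk -mulrA dvdp_mulr.
  by rewrite Gauss_dvdpl // coprimep_expl // coprimep_expr.
have : \prod_(s < n) L s ^+ e s %| p.
  elim: n {dvd} dvdp1 => [|n IHn] dvdp1; first by rewrite big_ord0 dvd1p.
  rewrite big_ord_recr /= Gauss_dvdp; first by rewrite IHn ?dvdp1 // => s /ltnW; apply: dvdp1.
  elim/big_ind: _ => [|x y cx cy|i _]; first exact: coprime1p.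
    by rewrite coprimepMl cx.
  by rewrite coprimep_expl // coprimep_expr // cL // ltn_eqF.
move=> /dvdpP [h ph]; exists (fun u => h.[u] / weight.[u] ^+ m); first by exists h, m.
move=> u cu; rewrite fE // ph hornerM horner_prod.
under eq_bigr do rewrite horner_exp.
by rewrite mulrA [h.[u] * _]mulrC.
Qed.

End Regular.

(** * Reflection-invariant regular functions are polynomials in eta *)

Definition refl (K : numFieldType) (cs : racah_case K) (D u : K) : K :=
  if cs is QRacah _ then (D * u)^-1 else - u - D.

Section Symmetric.

Variables (K : numFieldType) (cs : racah_case K).
Implicit Types (f g h : K -> K) (u D : K) (p Z : {poly K}) (l : params K).

Lemma coord_refl D u : coord cs D -> coord cs u -> coord cs (refl cs D u).
Proof. by case: cs => [|q] //= Dn0 un0; rewrite invr_eq0 mulf_neq0. Qed.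

Lemma reg_inv : regular cs (fun u => (weight cs).[u]^-1).
Proof. by exists 1, 1%N => u _; rewrite hornerC expr1 div1r. Qed.

Lemma reg_refl D : coord cs D -> regular cs (refl cs D).
Proof.
have := reg_inv; rewrite /refl /weight; case: cs => [|q] /= ri cD.
  exact: regB (regN (reg_id _)) (reg_cst _ D).
apply: reg_ext (regM (reg_cst _ D^-1) ri) => u cu.
by rewrite hornerX invfM.
Qed.

Lemma reg_refl_comp D f : coord cs D ->
  regular cs f -> regular cs (fun u => f (refl cs D u)).
Proof.
move=> cD; apply: reg_comp; [by move=> u; apply: coord_refl|exact: reg_refl|].
rewrite /refl /weight; case: cs cD => [|q] /= cD.
  by apply: reg_ext (reg_cst _ 1) => u _; rewrite hornerC invr1.
apply: reg_ext (regM (reg_cst _ D) (reg_id _)) => u cu.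
by rewrite hornerX invrK.
Qed.

Lemma reg_eta l : regular cs (eta cs l).
Proof.
have := reg_inv; rewrite /weight; case: l => a b c d; case: cs => [|q] /= ri.
  exact: regM (reg_id _) (regD (reg_id _) (reg_cst _ d)).
apply: regM; last first.
  exact: regB (reg_cst _ 1) (regM (reg_cst _ d) (reg_id _)).
by apply: regB (reg_cst _ 1); apply: reg_ext ri => u cu; rewrite hornerX.
Qed.

Lemma eta_refl l u : coord cs (pd l) -> coord cs u ->
  eta cs l (refl cs (pd l) u) = eta cs l u.
Proof.
case: l => a b c d; rewrite /refl; case: cs => [|q] /= dn0 un0; first by ring.
by field; rewrite dn0 un0.
Qed.

(** Divide by the invariant H = X (X + D). Reflecting the division gives another division of the
    same polynomial, so quotient and remainder are both invariant. The remainder has degree at most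
    1 and is constant, as its slope equals its own opposite; the quotient is handled by
    induction. *)
Lemma sym_poly_racah D p : (forall u, p.[- u - D] = p.[u]) ->
  exists h : {poly K}, forall u, p.[u] = h.[u * (u + D)].
Proof.
move: {2}(size p) (leqnn (size p)) => n.
elim: n p => [|n IHn] p sp psym.
  exists 0 => u; move: sp; rewrite leqn0 size_poly_eq0 => /eqP ->.
  by rewrite !horner0.
pose H : {poly K} := 'X * ('X + D%:P); pose S : {poly K} := - 'X - D%:P.
have HE u : H.[u] = u * (u + D) by rewrite !hornerE.
have SE u : S.[u] = - u - D by rewrite !hornerE.
have mH : H \is monic by rewrite monicMl ?monicX ?monicXaddC.
have sH : size H = 3%N.
  by rewrite size_monicM ?monicX ?polyXaddC_eq0 ?monic_neq0 ?monicXaddC // size_polyX size_XaddC.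
have Hn0 : H != 0 by rewrite monic_neq0.
set r := p %% H; set d := p %/ H.
have rE u : r.[u] = r`_0 + r`_1 * u.
  have : (size r <= 2)%N by rewrite -ltnS -sH ltn_modp.
  move=> /horner_coef_wide ->.
  by rewrite big_ord_recl big_ord1 /= mulr1 expr1.
have pE : p = d * H + r by rewrite {1}(divp_eq p H).
have psymP : p \Po S = p.
  apply/eqP; rewrite -subr_eq0; apply/eqP; apply: poly_vanish => u.
  by rewrite !hornerE horner_comp SE psym subrr.
have HS : H \Po S = H.
  apply/eqP; rewrite -subr_eq0; apply/eqP; apply: poly_vanish => u.
  by rewrite !hornerE horner_comp !HE SE; ring.
have rSE : r \Po S = (- r`_1) *: 'X + (r`_0 - r`_1 * D)%:P.
  apply/eqP; rewrite -subr_eq0; apply/eqP; apply: poly_vanish => u.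
  by rewrite !hornerE horner_comp !rE SE /=; ring.
have szr : (size (r \Po S)%R < size H)%N.
  rewrite sH rSE ltnS (leq_trans (size_polyD _ _)) // geq_max.
  rewrite (leq_trans (size_scale_leq _ _)) ?size_polyX //.
  by rewrite (leq_trans (size_polyC_leq1 _)).
have pS : p = (d \Po S) * H + (r \Po S).
  by rewrite -{1}psymP {1}pE comp_polyD comp_polyM HS.
have dS : d \Po S = d by rewrite {2}/d (divpP pS szr).
have rS : r \Po S = r by rewrite {2}/r (modpP pS szr).
have r1 : r`_1 = 0.
  have := congr1 (fun p : {poly K} => p`_1) rS.
  rewrite rSE coefD coefZ coefX poly.coefC /= mulr1 addr0 => /eqP.
  by rewrite -subr_eq0 -opprD oppr_eq0 -mulr2n mulrn_eq0 /= => /eqP.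
case: (eqVneq p 0) => [p0 | pn0].
  by exists 0 => u; rewrite p0 !horner0.
have [h hE] : exists h : {poly K}, forall u, d.[u] = h.[u * (u + D)].
  apply: IHn => [|u]; last by rewrite -SE -horner_comp dS.
  rewrite -ltnS (leq_trans _ sp) // /d size_divp // sH /= ltn_subrL /=.
  by rewrite size_poly_gt0.
exists (h * 'X + (r`_0)%:P) => u.
by rewrite {1}pE hornerD hornerM hE HE rE r1 mul0r addr0 !hornerE.
Qed.

(* [1/u + D u] is the eta of the q case up to an additive constant. *)
Lemma sym_poly_qracah D p m : D != 0 ->
  (forall u, u != 0 -> p.[(D * u)^-1] / (D * u)^-1 ^+ m = p.[u] / u ^+ m) ->
  exists h : {poly K}, forall u, u != 0 -> p.[u] / u ^+ m = h.[u^-1 + D * u].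
Proof.
move=> Dn0; elim: m p => [|m IHm] p psym.
  suff /size1_polyC -> : (size p <= 1)%N.
    by exists (p`_0)%:P => u _; rewrite expr0 divr1 !hornerC.
  set n := size p.
  (* [T] is u^n p(1/(D u)). Its size is at most n + 1, while ['X^n * p] has size 2 n for nonzero
     [p], which forces n <= 1. *)
  pose T : {poly K} := \sum_(i < n) (p`_i / D ^+ i) *: 'X^(n - i).
  have e : 'X^n * p = T.
    apply/eqP; rewrite -subr_eq0; apply/eqP.
    suff /eqP : ('X^n * p - T) * 'X = 0 by rewrite mulf_eq0 polyX_eq0 orbF => /eqP.
    apply: poly_vanish => u; rewrite !hornerE.
    case: (eqVneq u 0) => [-> | un0]; first by rewrite mulr0.
    have := psym u un0; rewrite !expr0 !divr1 => <-.
    rewrite horner_coef mulr_sumr /T horner_sum.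
    rewrite -sumrB big1 ?mul0r // => i _.
    rewrite hornerZ hornerXn exprVn exprMn invfM.
    have -> : u ^+ n = u ^+ (n - i) * u ^+ i by rewrite -exprD subnK // ltnW.
    by field; rewrite !expf_neq0 // ?mulf_neq0.
  have : (size T <= n.+1)%N.
    apply: (leq_trans (size_sum _ _ _)); apply/bigmax_leqP => i _.
    apply: (leq_trans (size_scale_leq _ _)).
    by rewrite size_polyXn ltnS leq_subr.
  rewrite -e; case: (eqVneq p 0) => [p0|pn0].
    by rewrite /n p0 size_poly0.
  rewrite mulrC size_Mmonic ?monicXn // size_polyXn addnS /= -/n.
  by rewrite -addn1 leq_add2l.
(* Since (1 + D u^2)^(m+1) / u^(m+1) = (1/u + D u)^(m+1), this subtracts an invariant function with
   the same pole at 0. The difference has a pole of order at most m. *)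
pose p1 := p - p`_0 *: (1 + D *: 'X^2) ^+ m.+1.
have : root p1 0.
  rewrite rootE /p1 hornerD hornerN hornerZ horner_exp !hornerD hornerZ hornerXn.
  by rewrite hornerC expr0n mulr0 addr0 expr1n mulr1 -horner_coef0 subrr.
move=> /factor_theorem [p2]; rewrite subr0 => p1E.
have fE u : u != 0 ->
    p.[u] / u ^+ m.+1 = p2.[u] / u ^+ m + p`_0 * (u^-1 + D * u) ^+ m.+1.
  move=> un0.
  have pE : p = p2 * 'X + p`_0 *: (1 + D *: 'X^2) ^+ m.+1.
    by rewrite -p1E /p1 subrK.
  rewrite {1}pE hornerD hornerMX hornerZ horner_exp hornerD hornerZ hornerXn hornerC.
  have -> : u^-1 + D * u = (1 + D * u ^+ 2) / u by field.
  rewrite expr_div_n mulrDl; congr (_ + _); last by rewrite -mulrA.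
  by rewrite exprS; field; rewrite un0 expf_neq0.
have [h hE] : exists h : {poly K},
    forall u, u != 0 -> p2.[u] / u ^+ m = h.[u^-1 + D * u].
  apply: IHm => u un0.
  have Dun0 : (D * u)^-1 != 0 by rewrite invr_eq0 mulf_neq0.
  have := psym u un0; rewrite !fE //.
  have -> : (D * u)^-1^-1 + D * (D * u)^-1 = u^-1 + D * u by field; rewrite un0.
  by move/addIr.
exists (h + p`_0 *: 'X ^+ m.+1) => u un0.
by rewrite fE // hE // !hornerE.
Qed.

(** Invariance is asked only off the zeros of [Z], because \check P_{D,n} is given by a quotient,
    meaningful only where phi does not vanish. *)
Lemma sym_poly l f Z : coord cs (pd l) -> Z != 0 -> regular cs f ->
  (forall u, coord cs u -> Z.[u] != 0 -> f (refl cs (pd l) u) = f u) ->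
  exists h : {poly K}, forall u, coord cs u -> h.[eta cs l u] = f u.
Proof.
move=> cD Zn0 rf fsymZ.
have fsym := reg_eq Zn0 (reg_refl_comp cD rf) rf fsymZ.
case: rf fsym => p [m fE] fsym; move: fE fsym cD {fsymZ}; rewrite /eq_coord.
rewrite /refl /weight; case: l => a b c d; case: cs => [|q] /= fE fsym cD.
  have {}fE u : f u = p.[u] by rewrite fE // hornerC expr1n divr1.
  have [u|h hE] := @sym_poly_racah d p; first by rewrite -!fE fsym.
  by exists h => u _; rewrite fE hE.
have {}fE u : u != 0 -> f u = p.[u] / u ^+ m by move=> un0; rewrite fE // hornerX.
have [u un0|h hE] := @sym_poly_qracah d p m cD.
  by rewrite -!fE ?fsym // invr_eq0 mulf_neq0.
exists (h \Po ('X + (1 + d)%:P)) => u un0; rewrite fE // hE // horner_comp.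
by congr (_.[_]); rewrite !hornerE /=; field.
Qed.

End Symmetric.

(** * The operator behind the coefficients R *)

Section JacobiOperator.

Variables (K : numFieldType) (A B C : int -> K).
Implicit Types (f g : int -> K) (h : nat -> K) (n m : int) (t : nat).

(* Multiplication by [eta] minus [x], on the index side. *)
Definition jacobi x f n := A n * f (n + 1) + (B n - x) * f n + C n * f (n - 1).

Fixpoint jacobi_iter h t f : int -> K :=
  if t is s.+1 then jacobi (h s) (jacobi_iter h s f) else f.

(** The test [0 <= m] makes the columns of negative index vanish, in accordance with R_{n,k} = 0 for
    n + k < 0. *)
Definition delta m n : K := ((n == m) && (0 <= m))%:R.

Lemma jacobi_eq x f g : f =1 g -> jacobi x f =1 jacobi x g.
Proof. by move=> fg n; rewrite /jacobi !fg. Qed.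

(** Both operators are one and the same operator minus a scalar. *)
Lemma jacobiC x y f : jacobi x (jacobi y f) =1 jacobi y (jacobi x f).
Proof. by move=> n; rewrite /jacobi addrK subrK; ring. Qed.

Lemma jacobi_iter_eq h h' t f : (forall i, (i < t)%N -> h i = h' i) ->
  jacobi_iter h t f =1 jacobi_iter h' t f.
Proof.
elim: t => //= t IHt hh' n; rewrite hh' //; apply: jacobi_eq.
by apply: IHt => i ti; apply: hh'; apply: ltnW.
Qed.

Lemma jacobi_iterSr h t f :
  jacobi_iter h t.+1 f =1 jacobi (h 0%N) (jacobi_iter (h \o succn) t f).
Proof.
elim: t => //= t IHt n.
by rewrite (jacobi_eq _ IHt) jacobiC.
Qed.

Lemma jacobi_iter_rev h t f :
  jacobi_iter (fun i => h (t.-1 - i)%N) t f =1 jacobi_iter h t f.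
Proof.
elim: t h => //= t IHt h n; rewrite -[RHS]/(jacobi_iter h t.+1 f n).
rewrite jacobi_iterSr subnn; apply: jacobi_eq => {}n.
rewrite -IHt; apply: jacobi_iter_eq => i it /=.
by congr h; lia.
Qed.

Lemma jacobi_iter_band h t m n :
  t%:Z < `|m - n| -> jacobi_iter h t (delta m) n = 0.
Proof.
elim: t n => [|t IHt] n /= lt.
  by rewrite /delta; case: (n =P m) => //= nm; move: lt; rewrite nm subrr normr0.
by rewrite /jacobi !IHt ?mulr0 ?addr0 //; lia.
Qed.

Lemma jacobi_iter_neg h t m n : m < 0 -> jacobi_iter h t (delta m) n = 0.
Proof.
move=> m0; elim: t n => [|t IHt] n /=; first by rewrite /delta leNgt m0 andbF.
by rewrite /jacobi !IHt !mulr0 !addr0.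
Qed.

(** [P] is an eigenvector with eigenvalue [y] as far as the index [N], so each factor acts on it as
    [y - h i]. Every factor raises the index by at most one, hence the condition [n + t <= N];
    [C 0 = 0] stops the descent below index 0. *)
Lemma jacobi_iter_sum h t y (P : int -> K) (N n : nat) : C 0 = 0 ->
  (forall k : nat, (k < N)%N -> jacobi y P k%:Z = 0) -> (n + t <= N)%N ->
  \sum_(m < N.+1) jacobi_iter h t (delta m%:Z) n%:Z * P m%:Z
  = (\prod_(i < t) (y - h i)) * P n%:Z.
Proof.
move=> C0 rec; elim: t n => [|t IHt] n le /=.
  have nN : (n < N.+1)%N by lia.
  rewrite big_ord0 (bigD1 (Ordinal nN)) //= /delta eqxx /= big1 ?addr0 //.
  move=> i ni; rewrite (_ : n%:Z == i%:Z = false) ?mul0r //.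
  by apply/negP; rewrite eqz_nat => /eqP e; case/eqP: ni; apply: val_inj.
rewrite /jacobi [in RHS]big_ord_recr /=.
under eq_bigr => m _ do rewrite 2!mulrDl -(mulrA (A _)) -(mulrA (B _ - _)) -(mulrA (C _)).
rewrite !big_split /= -!mulr_sumr.
have -> : n%:Z + 1 = n.+1%:Z by lia.
rewrite !IHt; try lia.
have Cn : C n * (\sum_(m < N.+1) jacobi_iter h t (delta m) (n%:Z - 1) * P m)
  = C n * (\prod_(i < t) (y - h i) * P (n%:Z - 1)).
  case: n le => [|n] le; first by rewrite C0 !mul0r.
  have -> : n.+1%:Z - 1 = n%:Z by lia.
  by rewrite IHt //; lia.
have := rec n; rewrite Cn /jacobi => /(_ ltac:(lia)).
have -> : n%:Z + 1 = n.+1%:Z by lia.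
move: (\prod_(i < t) _) => p e.
transitivity (p * (A n * P n.+1 + (B n - y) * P n + C n * P (n%:Z - 1))
  + p * (y - h t) * P n); first by ring.
by rewrite e mulr0 add0r.
Qed.

End JacobiOperator.

Section RcheckTheory.

Variables (K : numFieldType) (cs : racah_case K) (l : params K).

(** All three terms of the recursion keep [n + k] fixed. So R_{n,k} is the entry in row n and column
    n + k of a product of commuting operators, and its cut-offs express the band width and the
    absence of negative columns. *)
Lemma RcheckE t n k u :
  Rcheck cs l t n k u =
  jacobi_iter (coefA cs l) (coefB cs l) (coefC cs l)
    (fun i => eta cs l (cadd cs u i)) t (delta K (n + k)) n.
Proof.
elim: t n k => [|t IHt] n k.
  rewrite /= /delta; case: ifP => c.
    by rewrite (_ : _ && _ = false) //; apply/negP; lia.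
  by rewrite (_ : _ && _ = true) //; lia.
rewrite [LHS]/=; case: ifP => [/orP[c|c]|_].
- by rewrite jacobi_iter_band //; lia.
- by rewrite jacobi_iter_neg.
rewrite !IHt /= /jacobi.
have -> : n + 1 + (k - 1) = n + k by lia.
by have -> : n - 1 + (k + 1) = n + k by lia.
Qed.

Lemma reg_cadd j : regular cs (fun u => cadd cs u j).
Proof.
rewrite /cadd; case: cs => [|q]; first exact: regD (reg_id _) (reg_cst _ _).
exact: regM (reg_id _) (reg_cst _ _).
Qed.

End RcheckTheory.

(** * Three-term recurrence *)

Section ThreeTerm.

Variables (K : numFieldType).
Implicit Types (a b c d y z nu q : K) (n k j : nat).

(** Comparison of coefficients in a basis [F] on which multiplication by [y] is bidiagonal; [t0],
    [tm], [tp] are the coefficients of P_n, P_{n-1}, P_{n+1}. Termination, [t0 n.+1 = 0], removes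
    the boundary term. *)
Lemma three_term_series (e s F t0 tm tp : nat -> K) (y A C : K) n :
  (forall k, y * F k = e k * F k - s k * F k.+1) ->
  (forall k, (k <= n.+1)%N ->
     e k * t0 k - (if k is j.+1 then s j * t0 j else 0)
     = A * (tp k - t0 k) + C * (tm k - t0 k)) ->
  t0 n.+1 = 0 ->
  y * (\sum_(k < n.+2) t0 k * F k)
  = A * (\sum_(k < n.+2) tp k * F k) + (- A - C) * (\sum_(k < n.+2) t0 k * F k)
    + C * (\sum_(k < n.+2) tm k * F k).
Proof.
move=> yF rec t0n.
transitivity (\sum_(k < n.+2)
    (e k * t0 k - (if nat_of_ord k is j.+1 then s j * t0 j else 0)) * F k).
  under [RHS]eq_bigr do rewrite mulrBl.
  rewrite mulr_sumr sumrB [X in _ - X]big_ord_recl /= mul0r add0r.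
  rewrite (_ : \sum_(k < n.+1) _ = \sum_(k < n.+2) s k * t0 k * F k.+1).
    rewrite -sumrB; apply: eq_bigr => k _.
    by rewrite mulrCA yF; ring.
  by rewrite [RHS]big_ord_recr /= t0n mulr0 mul0r addr0.
rewrite !mulr_sumr -!big_split /=; apply: eq_bigr => k _.
by rewrite rec -1?ltnS //; ring.
Qed.

Lemma poch_racahS z k : poch (@Racah K) z k.+1 = poch Racah z k * (z + k%:R).
Proof. by rewrite /poch big_ord_recr. Qed.

Lemma poch_racahSl z k : poch (@Racah K) z k.+1 = z * poch Racah (z + 1) k.
Proof.
rewrite /poch big_ord_recl addr0; congr (_ * _); apply: eq_bigr => i _.
by rewrite /= /bump /= add1n -addrA -natr1 [1 + _]addrC.
Qed.

Lemma poch_qracahS q z k :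
  poch (QRacah q) z k.+1 = poch (QRacah q) z k * (1 - z * q ^+ k).
Proof. by rewrite /poch big_ord_recr. Qed.

Lemma poch_qracahSl q z k :
  poch (QRacah q) z k.+1 = (1 - z) * poch (QRacah q) (z * q) k.
Proof.
rewrite /poch big_ord_recl expr0 mulr1; congr (_ * _); apply: eq_bigr => i _.
by rewrite /= /bump /= add1n exprS mulrA.
Qed.

Lemma poch_racahNn n k : (n < k)%N -> poch (@Racah K) (- n%:R) k = 0.
Proof.
by move=> nk; rewrite /poch (bigD1 (Ordinal nk)) //= addNr mul0r.
Qed.

Lemma poch_qracahNn q n k : q != 0 -> (n < k)%N -> poch (QRacah q) (q ^- n) k = 0.
Proof.
move=> q0 nk; rewrite /poch (bigD1 (Ordinal nk)) //= mulVf ?subrr ?mul0r //.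
by rewrite expf_neq0.
Qed.

(** The index n is a free scalar [nu], so that the recurrence of the coefficients is a rational
    identity that also makes sense with [nu - 1] at n = 0. *)
Definition racah_term a b c dt nu k : K :=
  let P := poch (@Racah K) in
  P (- nu) k * P (nu + dt) k / (P a k * P b k * P c k * k`!%:R).

Lemma racah_term_rec a b c d nu j :
  let dt := a + b + c - d - 1 in
  let T := racah_term a b c dt in
  a + j%:R != 0 -> b + j%:R != 0 -> c + j%:R != 0 -> nu + dt != 0 ->
  2 * nu + dt != 0 -> 2 * nu + 1 + dt != 0 -> 2 * nu - 1 + dt != 0 ->
  j.+1%:R * (j.+1%:R + d) * T nu j.+1 - T nu j
  = (nu + a) * (nu + b) * (nu + c) * (nu + dt)
      / ((2 * nu + dt) * (2 * nu + 1 + dt)) * (T (nu + 1) j.+1 - T nu j.+1)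
    + (nu + dt - a) * (nu + dt - b) * (nu + dt - c) * nu
      / ((2 * nu - 1 + dt) * (2 * nu + dt)) * (T (nu - 1) j.+1 - T nu j.+1).
Proof.
move=> dt T aj bj cj n0 n1 n2 n3.
have [dE jE] : d = a + b + c - dt - 1 /\ j.+1%:R = j%:R + 1 :> K.
  by split; [rewrite /dt; ring | rewrite natr1].
have jn0 : j%:R + 1 != 0 :> K by rewrite -jE pnatr_eq0.
have e1 : poch Racah (- (nu + 1)) j.+1 = - (nu + 1) * poch (@Racah K) (- nu) j.
  by rewrite poch_racahSl opprD addrNK.
have e2 : (nu + dt) * poch (@Racah K) (nu + 1 + dt) j.+1
  = poch Racah (nu + dt) j * (nu + dt + j%:R) * (nu + dt + j%:R + 1).
  rewrite addrAC -poch_racahSl !poch_racahS; rewrite jE; ring.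
(* For n = 0 this cannot be solved for the shifted factorial; the factor [nu] is supplied by C_n. *)
have e3 : nu * poch (@Racah K) (- (nu - 1)) j.+1
  = - (poch Racah (- nu) j * (- nu + j%:R) * (- nu + j%:R + 1)).
  have -> : - (nu - 1) = - nu + 1 by ring.
  have := poch_racahSl (- nu) j.+1; rewrite !poch_racahS jE => e.
  apply: oppr_inj; rewrite -mulNr -e; ring.
have e4 : poch Racah (nu - 1 + dt) j.+1
    = (nu - 1 + dt) * poch (@Racah K) (nu + dt) j.
  by rewrite poch_racahSl; congr (_ * poch _ _ _); ring.
rewrite /T /racah_term e1 e4 !(poch_racahS (- nu)) !(poch_racahS (nu + dt)).
rewrite !(poch_racahS a) !(poch_racahS b) !(poch_racahS c) factS natrM jE dE.
move: e2 e3; set Y1 := poch _ _ j.+1; set X2 := poch _ _ j.+1.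
set x := poch _ (- nu) j; set y := poch _ (nu + dt) j.
set D1 := poch _ a j; set D2 := poch _ b j; set D3 := poch _ c j.
(* The common lower factorials enter only through their inverses. Taken as new variables, these
   impose no nonvanishing condition on [field]. *)
rewrite !invfM; move: D1^-1 D2^-1 D3^-1 (_`!%:R^-1) => I1 I2 I3 I4 e2 e3.
move: dt j%:R Y1 X2 x y e2 e3 aj bj cj n0 n1 n2 n3 jn0 {T dE jE e1 e4 D1 D2 D3}.
move=> dt w Y1 X2 x y e2 e3 aj bj cj n0 n1 n2 n3 jn0.
have {e2} -> : Y1 = y * (nu + dt + w) * (nu + dt + w + 1) / (nu + dt).
  by rewrite -e2 mulrC mulKf.
set R := (nu + dt - a) * (nu + dt - b) * (nu + dt - c)
     * ((2 * nu - 1 + dt)^-1 * (2 * nu + dt)^-1).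
have -> : (nu + dt - a) * (nu + dt - b) * (nu + dt - c) * nu
     * ((2 * nu - 1 + dt)^-1 * (2 * nu + dt)^-1) = R * nu by rewrite /R mulrAC.
set I := I1 / _ * _ * _ * _; set t0 := x * _ * _ * _.
have -> : R * nu * (X2 * ((nu - 1 + dt) * y) * I - t0)
  = R * (nu * X2) * ((nu - 1 + dt) * y) * I - R * nu * t0 by ring.
rewrite e3 /R /t0 /I.
by field; rewrite ?n0 ?n1 ?n2 ?n3 ?aj ?bj ?cj ?jn0.
Qed.

(** Here [N] is a free scalar standing for q^n; it is unrelated to the truncation a = q^-N. *)
Definition qracah_term q a b c dt N k : K :=
  let P := poch (QRacah q) in
  P N^-1 k * P (dt * N) k * q ^+ k / (P a k * P b k * P c k * P q k).

Lemma qracah_term_rec q a b c d N j :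
  let dt := a * b * c * d^-1 * q^-1 in
  let T := qracah_term q a b c dt in
  a != 0 -> b != 0 -> c != 0 -> d != 0 -> q != 0 -> N != 0 ->
  1 - a * q ^+ j != 0 -> 1 - b * q ^+ j != 0 -> 1 - c * q ^+ j != 0 ->
  1 - q * q ^+ j != 0 -> 1 - dt * N != 0 ->
  1 - dt * N ^+ 2 != 0 -> 1 - dt * (N ^+ 2 * q) != 0 ->
  1 - dt * (N ^+ 2 / q) != 0 ->
  (q ^- j.+1 - 1) * (1 - d * q ^+ j.+1) * T N j.+1 - q ^- j * T N j
  = (1 - a * N) * (1 - b * N) * (1 - c * N) * (1 - dt * N)
      / ((1 - dt * N ^+ 2) * (1 - dt * (N ^+ 2 * q))) * (T (N * q) j.+1 - T N j.+1)
    + d * ((1 - a^-1 * dt * N) * (1 - b^-1 * dt * N) * (1 - c^-1 * dt * N) * (1 - N)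
      / ((1 - dt * (N ^+ 2 / q)) * (1 - dt * N ^+ 2))) * (T (N / q) j.+1 - T N j.+1).
Proof.
move=> dt T a0 b0 c0 d0 q0 N0 aj bj cj qj n0 n1 n2 n3.
have wn0 : q ^+ j != 0 by rewrite expf_neq0.
have dE : d = a * b * c / dt / q by rewrite /dt; field; rewrite a0 b0 c0 d0 q0.
have dtn0 : dt != 0 by rewrite /dt !mulf_neq0 ?invr_eq0.
have e1 : poch (QRacah q) (N * q)^-1 j.+1 = (1 - (N * q)^-1) * poch (QRacah q) N^-1 j.
  by rewrite poch_qracahSl invfM mulfVK.
have e2 : (1 - dt * N) * poch (QRacah q) (dt * (N * q)) j.+1
  = poch (QRacah q) (dt * N) j * (1 - dt * N * q ^+ j) * (1 - dt * N * q ^+ j * q).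
  by rewrite mulrA -poch_qracahSl !poch_qracahS exprSr -!mulrA.
(* The factor [1 - N] vanishes for n = 0; as in the Racah case it is supplied by C_n. *)
have e3 : (1 - N) * poch (QRacah q) (N / q)^-1 j.+1
  = - N * (poch (QRacah q) N^-1 j * (1 - N^-1 * q ^+ j) * (1 - N^-1 * q ^+ j * q)).
  have -> : (N / q)^-1 = N^-1 * q by rewrite invfM invrK.
  have := poch_qracahSl q N^-1 j.+1; rewrite !(poch_qracahS _ N^-1) exprSr => e.
  have -> : 1 - N = - N * (1 - N^-1) by field.
  by rewrite -mulrA -e -!mulrA.
have e4 : poch (QRacah q) (dt * (N / q)) j.+1
    = (1 - dt * (N / q)) * poch (QRacah q) (dt * N) j.
  by rewrite poch_qracahSl mulrA mulfVK.
rewrite /T /qracah_term e1 e4 !(poch_qracahS _ N^-1) !(poch_qracahS _ (dt * N)).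
rewrite !(poch_qracahS _ a) !(poch_qracahS _ b) !(poch_qracahS _ c).
rewrite !(poch_qracahS _ q) !(exprSr q) dE.
move: e2 e3; set Y1 := poch _ _ j.+1; set X2 := poch _ _ j.+1.
set x := poch _ N^-1 j; set y := poch _ (dt * N) j.
set D1 := poch _ a j; set D2 := poch _ b j; set D3 := poch _ c j.
set D4 := poch _ q j.
have inv4 (A1 A2 A3 A4 B1 B2 B3 B4 : K) :
    (A1 * B1 * (A2 * B2) * (A3 * B3) * (A4 * B4))^-1
  = A1^-1 * A2^-1 * A3^-1 * A4^-1 * (B1 * B2 * B3 * B4)^-1.
  by rewrite !invfM; ring.
have inv4' (A1 A2 A3 A4 : K) :
    (A1 * A2 * A3 * A4)^-1 = A1^-1 * A2^-1 * A3^-1 * A4^-1.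
  by rewrite !invfM; ring.
rewrite !inv4 (inv4' D1) {inv4 inv4'}.
move: D1^-1 D2^-1 D3^-1 D4^-1 => I1 I2 I3 I4 e2 e3.
move: dt (q ^+ j) Y1 X2 x y wn0 dtn0 e2 e3 aj bj cj qj n0 n1 n2 n3 {T dE e1 e4 D1 D2 D3 D4}.
move=> dt w Y1 X2 x y wn0 dtn0 e2 e3 aj bj cj qj n0 n1 n2 n3.
have {e2} -> : Y1 = y * (1 - dt * N * w) * (1 - dt * N * w * q) / (1 - dt * N).
  by rewrite -e2 mulrC mulKf.
have {}n3 : q - dt * N ^+ 2 != 0.
  have e : 1 - dt * (N ^+ 2 / q) = (q - dt * N ^+ 2) / q by field.
  by move: n3; rewrite e mulf_eq0 negb_or => /andP[].
set I := _ / ((1 - a * w) * _ * _ * _); set t0 := x * _ * _ * _ * I.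
set R := (1 - a^-1 * dt * N) * (1 - b^-1 * dt * N) * (1 - c^-1 * dt * N).
set Q := _ / ((1 - dt * (N ^+ 2 / q)) * _); set Z := (1 - dt * (N / q)) * y.
set w' := w * q.
have -> : a * b * c / dt / q * Q * (X2 * Z * w' * I - t0)
  = a * b * c / dt / q * (R / ((1 - dt * (N ^+ 2 / q)) * (1 - dt * N ^+ 2)))
     * ((1 - N) * X2 * Z * w' * I - (1 - N) * t0) by rewrite /Q; ring.
rewrite e3 /R /t0 /I /Q /Z /w'.
by field; rewrite ?a0 ?b0 ?c0 ?q0 ?N0 ?wn0 ?dtn0 ?n0 ?n1 ?n2 ?n3 ?aj ?bj ?cj ?qj.
Qed.

End ThreeTerm.

(* The genericity conditions, cleared of denominators; [B] bounds the degrees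
   n for which P_n is used, so that [a = -N], resp. [a = q^-N], is allowed for
   [B <= N]. *)
Record good_racah (K : numFieldType) (a b c d : K) (B : nat) : Prop := {
  gr_a : forall i, (i < B)%N -> a + i%:R != 0;
  gr_b : forall i, b + i%:R != 0;
  gr_c : forall i, c + i%:R != 0;
  gr_d : forall i, d + i%:R != 0;
  gr_dt : forall i, a + b + c - d - 1 - 1 + i%:R != 0;
  gr_da : forall i, d - a + 1 + i%:R != 0;
  gr_db : forall i, d - b + 1 + i%:R != 0;
  gr_ev : forall i j, a + b - d - 1 + i%:R - j%:R != 0;
  gr_vv : forall i, a + b - c - d - 1 - i%:R != 0
}.

Record good_qracah (K : numFieldType) (q a b c d : K) (B : nat) : Prop := {
  gq_a0 : a != 0;
  gq_b0 : b != 0;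
  gq_c0 : c != 0;
  gq_d0 : d != 0;
  gq_a : forall i, (i < B)%N -> 1 - a * q ^+ i != 0;
  gq_b : forall i, 1 - b * q ^+ i != 0;
  gq_c : forall i, 1 - c * q ^+ i != 0;
  gq_d : forall i, 1 - d * q ^+ i != 0;
  gq_dt : forall i, d * q ^+ 2 - a * b * c * q ^+ i != 0;
  gq_da : forall i, a - d * q ^+ i.+1 != 0;
  gq_db : forall i, b - d * q ^+ i.+1 != 0;
  gq_ev : forall i j, d * q * q ^+ j - a * b * q ^+ i != 0;
  gq_vv : forall i, c * d * q * q ^+ i - a * b != 0
}.

Definition good (K : numFieldType) (cs : racah_case K) (l : params K) (B : nat) :=
  let: Params a b c d := l in
  match cs with
  | Racah => good_racah a b c d B
  | QRacah q => good_qracah q a b c d B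
  end.

(** * The (q-)Racah polynomials and their recurrence *)

Section Polynomials.

Variables (K : numFieldType).
Implicit Types (cs : racah_case K) (l : params K) (a b c d q u : K) (n k : nat).

Lemma qcase_neq0 q : valid_case (QRacah q) -> q != 0.
Proof. by case/andP => /lt0r_neq0. Qed.

Lemma qpow_neq1 q n : valid_case (QRacah q) -> (0 < n)%N -> 1 - q ^+ n != 0.
Proof.
move=> /andP[q0 q1] n0; rewrite subr_eq0 eq_sym lt_eqF //.
by rewrite exprn_ilt1 ?(ltW q0) -?lt0n.
Qed.

(** It is the product of the i (i + d) - eta for i < k, hence a polynomial in eta of degree k. *)
Definition basis_racah d u k : K := poch Racah (- u) k * poch Racah (u + d) k.

(** The neighbours n - 1, n, n + 1 are compared over one common range. The added terms contain
    (-n)_k = 0, whatever the lower factorials are. *)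
Lemma Pcheck_racahE a b c d n N u : (n < N)%N ->
  Pcheck Racah (Params a b c d) n u
  = \sum_(k < N) racah_term a b c (a + b + c - d - 1) n%:R k * basis_racah d u k.
Proof.
move=> nN; rewrite /Pcheck /hyper /dtilde.
transitivity (\sum_(k < n.+1) racah_term a b c (a + b + c - d - 1) n%:R k * basis_racah d u k).
  apply: eq_bigr => k _; rewrite /pochs !big_cons !big_nil /racah_term /basis_racah.
  by rewrite !mulr1 !invfM; ring.
rewrite (big_ord_widen N (fun k => racah_term a b c (a + b + c - d - 1) n%:R k * basis_racah d u k)) //.
rewrite big_mkcond; apply: eq_bigr => k _; case: ifPn => //.
by rewrite -ltnNge /racah_term => nk; rewrite poch_racahNn // !mul0r.
Qed.

Definition basis_qracah q d u k : K :=
  poch (QRacah q) u^-1 k * poch (QRacah q) (d * u) k.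

Lemma Pcheck_qracahE q a b c d n N u : q != 0 -> (n < N)%N ->
  Pcheck (QRacah q) (Params a b c d) n u
  = \sum_(k < N) qracah_term q a b c (a * b * c * d^-1 * q^-1) (q ^+ n) k
       * basis_qracah q d u k.
Proof.
move=> q0 nN; rewrite /Pcheck /hyper /dtilde.
transitivity (\sum_(k < n.+1) qracah_term q a b c (a * b * c * d^-1 * q^-1) (q ^+ n) k * basis_qracah q d u k).
  apply: eq_bigr => k _; rewrite /pochs !big_cons !big_nil /qracah_term /basis_qracah.
  by rewrite !mulr1 !invfM; ring.
rewrite (big_ord_widen N (fun k => qracah_term q a b c (a * b * c * d^-1 * q^-1) (q ^+ n) k * basis_qracah q d u k)) //.
rewrite big_mkcond; apply: eq_bigr => k _; case: ifPn => //.
by rewrite -ltnNge /qracah_term => nk; rewrite poch_qracahNn // !mul0r.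
Qed.

Lemma Pcheck_poly cs l n : valid_case cs ->
  exists p : {poly K}, forall u, coord cs u -> Pcheck cs l n u = p.[eta cs l u].
Proof.
case: l => a b c d; case: cs => [|q] v.
  exists (\sum_(k < n.+1) racah_term a b c (a + b + c - d - 1) n%:R k *:
    \prod_(i < k) ((i%:R * (i%:R + d))%:P - 'X)) => u _.
  rewrite (Pcheck_racahE _ _ _ _ _ (ltnSn n)) horner_sum; apply: eq_bigr => k _.
  rewrite hornerZ horner_prod /basis_racah /poch -big_split /=.
  by congr (_ * _); apply: eq_bigr => i _; rewrite !hornerE /=; ring.
have q0 := qcase_neq0 v.
exists (\sum_(k < n.+1)
  qracah_term q a b c (a * b * c * d^-1 * q^-1) (q ^+ n) k *:
    \prod_(i < k) ((1 + d * (q ^+ i) ^+ 2 - q ^+ i * (1 + d))%:P - q ^+ i *: 'X)).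
move=> u un0.
rewrite (Pcheck_qracahE _ _ _ _ _ q0 (ltnSn n)) horner_sum; apply: eq_bigr => k _.
rewrite hornerZ horner_prod /basis_qracah /poch -big_split /=.
by congr (_ * _); apply: eq_bigr => i _; rewrite !hornerE /=; field.
Qed.

Definition Pcheck_int cs l u (m : int) : K :=
  if m is Posz n then Pcheck cs l n u else 0.

Lemma Pcheck_intE cs l u n : Pcheck_int cs l u n%:Z = Pcheck cs l n u.
Proof. by []. Qed.

Lemma coefC0 cs l : coefC cs l 0 = 0.
Proof.
case: l => a b c d; case: cs => [|q] /=; first by rewrite mulr0 mul0r.
by rewrite expr0z subrr !(mulr0, mul0r).
Qed.

Lemma Pcheck_rec_racah a b c d B n u : good_racah a b c d B -> (n < B)%N ->
  let l := Params a b c d in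
  jacobi (coefA Racah l) (coefB Racah l) (coefC Racah l) (eta Racah l u)
    (Pcheck_int Racah l u) n%:Z = 0.
Proof.
move=> g nB l; have cC0 := coefC0 Racah l.
set dt := a + b + c - d - 1.
pose T := racah_term a b c dt.
have PE k N : (k < N)%N ->
    Pcheck Racah l k u = \sum_(j < N) T k%:R j * basis_racah d u j.
  exact: Pcheck_racahE.
have n1 : n%:R + dt != 0.
  have -> : n%:R + dt = dt - 1 + n.+1%:R by rewrite -natr1; ring.
  exact: (gr_dt g).
have dbl j : (n.*2 + j)%:R = 2 * n%:R + j%:R :> K by rewrite natrD -mul2n natrM.
have n2 : 2 * n%:R + dt != 0.
  have -> : 2 * n%:R + dt = dt - 1 + (n.*2 + 1)%:R by rewrite dbl; ring.
  exact: (gr_dt g).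
have n3 : 2 * n%:R + 1 + dt != 0.
  have -> : 2 * n%:R + 1 + dt = dt - 1 + (n.*2 + 2)%:R by rewrite dbl; ring.
  exact: (gr_dt g).
(* At n = 0 this is dt - 1, which is why [gr_dt] starts there. *)
have n4 : 2 * n%:R - 1 + dt != 0.
  have -> : 2 * n%:R - 1 + dt = dt - 1 + (n.*2 + 0)%:R by rewrite dbl; ring.
  exact: (gr_dt g).
(* At n = 0 the series with parameter n - 1 does not represent P_{-1} = 0, but both sides vanish
   because C_0 = 0. *)
have CP : coefC Racah l n * Pcheck_int Racah l u (n%:Z - 1)
  = coefC Racah l n * \sum_(k < n.+2) T (n%:R - 1) k * basis_racah d u k.
  case: n {n1 n2 n3 n4 dbl} nB => [|n] nB; first by rewrite cC0 !mul0r.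
  have -> : n.+1%:Z - 1 = n%:Z by lia.
  have lt : (n < n.+3)%N by lia.
  rewrite Pcheck_intE (PE n n.+3 lt).
  have -> : n.+1%:R - 1 = n%:R :> K by rewrite -natr1 addrK.
  reflexivity.
rewrite /jacobi CP (_ : n%:Z + 1 = n.+1%:Z); last by lia.
rewrite !Pcheck_intE !(PE _ n.+2) // -[n.+1%:R]natr1.
(* This is eta at x = k: passing from the basis element k to k + 1 multiplies it by [e k - eta]. *)
pose e k := k%:R * (k%:R + d).
rewrite mulrBl.
rewrite (@three_term_series K e (fun=> 1) (basis_racah d u) (T n%:R)
  (T (n%:R - 1)) (T (n%:R + 1)) (eta Racah l u) (coefA Racah l n) (coefC Racah l n) n);
  [by rewrite /coefB; ring|move=> k|case=> [|k] kn|].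
- by rewrite /basis_racah !poch_racahS /e /=; ring.
- rewrite /e mul0r mul0r subr0 /T /racah_term /poch !big_ord0.
  by rewrite !subrr !mulr0 addr0.
- rewrite mul1r /e /T racah_term_rec //.
  by apply: (gr_a g); apply: leq_ltn_trans nB.
  by apply: (gr_b g).
  by apply: (gr_c g).
- by rewrite /T /racah_term poch_racahNn // !mul0r.
Qed.

Lemma Pcheck_rec_qracah q a b c d B n u :
  valid_case (QRacah q) -> good_qracah q a b c d B -> (n < B)%N -> u != 0 ->
  let l := Params a b c d in let cs := QRacah q in
  jacobi (coefA cs l) (coefB cs l) (coefC cs l) (eta cs l u)
    (Pcheck_int cs l u) n%:Z = 0.
Proof.
move=> v g nB un0 l cs; have cC0 := coefC0 cs l.
have q0 := qcase_neq0 v; have d0 := gq_d0 g.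
set dt := a * b * c * d^-1 * q^-1.
pose T := qracah_term q a b c dt.
have PE k N : (k < N)%N ->
    Pcheck cs l k u = \sum_(j < N) T (q ^+ k) j * basis_qracah q d u j.
  exact: Pcheck_qracahE.
have dtn k : 1 - dt * (q ^+ k / q) != 0.
  have -> : 1 - dt * (q ^+ k / q) = (d * q ^+ 2 - a * b * c * q ^+ k) / (d * q ^+ 2).
    by rewrite /dt; field; rewrite d0 q0.
  by rewrite mulf_neq0 ?invr_eq0 ?mulf_neq0 ?expf_neq0 ?(gq_dt g).
have n1 : 1 - dt * q ^+ n != 0.
  by have := dtn n.+1; rewrite exprSr mulfK.
have n2 : 1 - dt * (q ^+ n) ^+ 2 != 0.
  by have := dtn (n * 2).+1; rewrite exprSr mulfK // exprM.
have n3 : 1 - dt * ((q ^+ n) ^+ 2 * q) != 0.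
  by have := dtn (n * 2).+2; rewrite exprSr mulfK // exprSr exprM.
have n4 : 1 - dt * ((q ^+ n) ^+ 2 / q) != 0.
  by have := dtn (n * 2)%N; rewrite exprM.
have CP : coefC cs l n * Pcheck_int cs l u (n%:Z - 1)
  = coefC cs l n * \sum_(k < n.+2) T (q ^+ n / q) k * basis_qracah q d u k.
  case: n {n1 n2 n3 n4} nB => [|n] nB; first by rewrite cC0 !mul0r.
  have -> : n.+1%:Z - 1 = n%:Z by lia.
  have lt : (n < n.+3)%N by lia.
  rewrite Pcheck_intE (PE n n.+3 lt).
  have -> : q ^+ n.+1 / q = q ^+ n by rewrite exprSr mulfK.
  reflexivity.
rewrite /jacobi CP (_ : n%:Z + 1 = n.+1%:Z); last by lia.
rewrite !Pcheck_intE !(PE _ n.+2) // exprSr.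
pose e k := (q ^- k - 1) * (1 - d * q ^+ k).
rewrite mulrBl.
rewrite (@three_term_series K e (fun k => q ^- k) (basis_qracah q d u) (T (q ^+ n))
  (T (q ^+ n / q)) (T (q ^+ n * q)) (eta cs l u) (coefA cs l n) (coefC cs l n) n);
  [by rewrite /coefB; ring|move=> k|case=> [|k] kn|].
- have qk : q ^+ k != 0 by rewrite expf_neq0.
  rewrite /basis_qracah !poch_qracahS /e /=; field.
  by rewrite qk un0.
- rewrite /e invr1 subrr !mul0r subr0 /T /qracah_term /poch !big_ord0.
  by rewrite !subrr !mulr0 addr0.
- rewrite /e /T qracah_term_rec ?(gq_a0 g) ?(gq_b0 g) ?(gq_c0 g) ?expf_neq0 //; first 1 last.
  + by apply: (gq_a g); apply: leq_ltn_trans nB.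
  + by apply: (gq_b g).
  + by apply: (gq_c g).
  + by rewrite -exprS qpow_neq1.
  have e1 : q ^ (2 * n%:Z) = (q ^+ n) ^+ 2.
    by rewrite -exprM mulnC exprnP PoszM.
  have e2 : q ^ (2 * n%:Z + 1) = (q ^+ n) ^+ 2 * q.
    by rewrite expfzDr // e1 expr1z.
  have e3 : q ^ (2 * n%:Z - 1) = (q ^+ n) ^+ 2 / q.
    by rewrite expfzDr // e1.
  by rewrite /coefA /coefC /= e1 e2 e3.
- by rewrite /T /qracah_term poch_qracahNn // !mul0r.
Qed.

Lemma Pcheck_rec cs l B n u :
  valid_case cs -> good cs l B -> (n < B)%N -> coord cs u ->
  jacobi (coefA cs l) (coefB cs l) (coefC cs l) (eta cs l u)
    (Pcheck_int cs l u) n%:Z = 0.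
Proof.
case: l => a b c d; case: cs => [|q] v g nB cu.
  exact: Pcheck_rec_racah g nB.
exact: Pcheck_rec_qracah v g nB cu.
Qed.

End Polynomials.

(** * Divisibility of the determinant *)

Section Congruence.

Variables (K : numFieldType) (cs : racah_case K).
Implicit Types (f g h : K -> K) (L p : {poly K}) (u : K).

Definition reg_congr L f g :=
  exists2 h, regular cs h & forall u, coord cs u -> f u - g u = L.[u] * h u.

Lemma reg_congr_refl L f : reg_congr L f f.
Proof. by exists (fun=> 0); [exact: reg_cst | move=> u _; rewrite subrr mulr0]. Qed.

Lemma reg_congrM L f f' g g' : regular cs f' -> regular cs g ->
  reg_congr L f f' -> reg_congr L g g' ->
  reg_congr L (fun u => f u * g u) (fun u => f' u * g' u).
Proof.
move=> rf' rg [h rh fE] [k rk gE]; exists (fun u => h u * g u + f' u * k u).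
  exact: regD (regM rh rg) (regM rf' rk).
move=> u cu; rewrite mulrDr mulrA -fE // mulrCA -gE //; ring.
Qed.

Lemma reg_congr_prod (I : eqType) (r : seq I) L (F G : I -> K -> K) :
  (forall i, regular cs (F i)) -> (forall i, regular cs (G i)) ->
  (forall i, i \in r -> reg_congr L (F i) (G i)) ->
  reg_congr L (fun u => \prod_(i <- r) F i u) (fun u => \prod_(i <- r) G i u).
Proof.
move=> rF rG; elim: r => [|i r IHr] FG.
  exists (fun=> 0); first exact: reg_cst.
  by move=> u _; rewrite !big_nil subrr mulr0.
have FGi : reg_congr L (F i) (G i) by apply: FG; rewrite mem_head.
have FGr : reg_congr L (fun u => \prod_(i <- r) F i u) (fun u => \prod_(i <- r) G i u).
  by apply: IHr => j jr; apply: FG; rewrite in_cons jr orbT.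
have [|h rh hE] := reg_congrM (rG i) _ FGi FGr; first exact: reg_prod.
by exists h => // u cu; rewrite !big_cons hE.
Qed.

Lemma reg_congr_horner L p f g : regular cs f -> regular cs g ->
  reg_congr L f g -> reg_congr L (fun u => p.[f u]) (fun u => p.[g u]).
Proof.
move=> rf rg fg; elim/poly_ind: p => [|p c IHp].
  exists (fun=> 0); first exact: reg_cst.
  by move=> u _; rewrite !horner0 subrr mulr0.
have [|h rh hE] := reg_congrM _ rf IHp fg; first exact: reg_horner.
by exists h => // u cu; rewrite !hornerMXaddC -hE //; ring.
Qed.

(** The congruences between rows need not survive the subtraction made for another [s]. Each [s]
    therefore starts again from [A], and [reg_dvd] joins the results. *)
Lemma reg_det_dvd M (A : K -> 'M[K]_M.+1) (L : nat -> {poly K}) :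
  (forall s, coprimep (L s) (weight cs)) ->
  (forall s t, s != t -> coprimep (L s) (L t)) ->
  (forall i c, regular cs (fun u => A u i c)) ->
  (forall (j k : 'I_M.+1) c, (j < k)%N ->
     reg_congr (L (j + k)%N) (fun u => A u k c) (fun u => A u j c)) ->
  exists2 g, regular cs g &
    eq_coord cs (fun u => \det (A u))
      (fun u => (\prod_(k < M.+1) \prod_(j < k) (L (j + k)%N).[u]) * g u).
Proof.
move=> cw cL rA cA.
pose e s := #|[pred i : 'I_M.+1 | (i <= s < i + i)%N]|.
have [s sM|g rg gE] := @reg_dvd _ cs (M + M).+1 L e _ cw cL (reg_det rA).
  pose P := [pred i : 'I_M.+1 | (i <= s < i + i)%N].
  pose f (i : 'I_M.+1) : 'I_M.+1 := inord (s - i).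
  have fE i : P i -> f i = (s - i)%N :> nat.
    by move=> /= Pi; rewrite inordK //; have := ltn_ord i; lia.
  have ltf i : P i -> (f i < i)%N by move=> Pi; rewrite fE //; move: Pi => /=; lia.
  (* The quotients are chosen for all entries as functions of [u], so that the folded matrix has
     regular entries. *)
  have /fin_all_exists [h hP] (ic : 'I_M.+1 * 'I_M.+1) : exists h : K -> K,
      regular cs h /\ (P ic.1 -> forall u, coord cs u ->
        A u ic.1 ic.2 - A u (f ic.1) ic.2 = (L s).[u] * h u).
    case: (boolP (P ic.1)) => [Pi|_]; last by exists (fun=> 0); split=> //; exact: reg_cst.
    have [h rh hE] := cA _ _ ic.2 (ltf _ Pi); exists h; split=> // _ u cu.
    by rewrite hE // fE // subnK //; case/andP: Pi.
  pose B u : 'M[K]_M.+1 := \matrix_(i, c) if P i then h (i, c) u else A u i c.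
  exists (fun u => \det (B u)).
    apply: reg_det => i c; case Pi: (P i).
      by apply: reg_ext (hP (i, c)).1 => u _; rewrite mxE Pi.
    by apply: reg_ext (rA i c) => u _; rewrite mxE Pi.
  move=> u cu; rewrite -horner_exp horner_exp; apply: (det_fold (f := f)) => //.
    by move=> i c Pi; rewrite mxE Pi; apply: (hP (i, c)).2.
  by move=> i c Pi; rewrite mxE (negPf Pi).
by exists g => // u cu; rewrite gE // (prod_pairs M (fun s => (L s).[u])).
Qed.

End Congruence.

(** * The irreducible data: factors of phi and of the row multipliers *)

Section Factors.

Variables (K : numFieldType) (cs : racah_case K).
Hypothesis hcs : valid_case cs.
Implicit Types (l : params K) (u y z : K) (i j k s t M B : nat).

(* For s = j + k, vanishes exactly when the reflection x -> -x-d exchanges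
   x + j and x + k. *)
Definition Lfac l s : {poly K} :=
  match cs with
  | Racah => 2 *: 'X + (s%:R + pd l)%:P
  | QRacah q => 1 - (pd l * q ^+ s) *: 'X^2
  end.

(* Up to a factor independent of i, [rfactor l M i u] is a product of values of
   [Vfac] and [Wfac], which the reflection exchanges; see [VWprod]. *)
Definition Vfac l y : K :=
  let: Params a b c d := l in
  match cs with
  | Racah => (y + a) * (y + b)
  | QRacah q => (1 - a * y) * (1 - b * y) * (d / (a * b)) / y
  end.

Definition Wfac l y : K :=
  let: Params a b c d := l in
  match cs with
  | Racah => (y + d - a) * (y + d - b)
  | QRacah q => (1 - a^-1 * d * y) * (1 - b^-1 * d * y) / y
  end.

Lemma coord_cadd u j : coord cs u -> coord cs (cadd cs u j).
Proof.
move: hcs; case: cs => [|q] //= v un0.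
by rewrite mulf_neq0 // expf_neq0 // qcase_neq0.
Qed.

Lemma coord_cnat j : coord cs (cnat cs j).
Proof. by move: hcs; case: cs => [|q] //= v; rewrite expf_neq0 // qcase_neq0. Qed.

Lemma coord_pd l B : good cs l B -> coord cs (pd l).
Proof. by case: l => a b c d; case: cs => [|q] //= /gq_d0. Qed.

Lemma coord_pd_shift l B M : good cs l B -> coord cs (pd (shift cs l M)).
Proof.
move: hcs; case: l => a b c d; case: cs => [|q] //= v /gq_d0 d0.
by rewrite mulf_neq0 // expf_neq0 // qcase_neq0.
Qed.

Lemma Lfac_weight l s : coprimep (Lfac l s) (weight cs).
Proof.
rewrite /weight /Lfac; case: cs => [|q]; first exact: coprimep1.
by rewrite coprimepX rootE hornerD hornerN hornerZ hornerXn hornerC expr0n mulr0 subr0 oner_eq0.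
Qed.

(** A combination of the two is a nonzero constant: L_t - L_s = t - s (R), L_t - q^(t-s) L_s = 1 -
    q^(t-s) (qR). *)
Lemma Lfac_coprime l B s t : good cs l B -> s != t -> coprimep (Lfac l s) (Lfac l t).
Proof.
move=> g; wlog st : s t / (s < t)%N.
  move=> H nst; have := nst; rewrite neq_ltn => /orP[st|ts]; first exact: H.
  by rewrite coprimep_sym H // eq_sym.
move=> _; move: hcs g; rewrite /Lfac; case: l => a b c d; case: cs => [|q] /= v g.
  apply/Bezout_coprimepP; exists (-1, 1) => /=.
  set x := (X in X %= 1).
  have -> : x = (t%:R - s%:R)%:P.
    by rewrite /x -!mul_polyC !polyCD polyCN; ring.
  rewrite -size_poly_eq1 size_polyC subr_eq0 eqr_nat.
  by rewrite neq_ltn st orbT.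
have d0 := gq_d0 g.
apply/Bezout_coprimepP; exists (- (q ^+ (t - s))%:P, 1) => /=.
set x := (X in X %= 1).
have -> : x = (1 - q ^+ (t - s))%:P.
  rewrite /x (_ : q ^+ t = q ^+ (t - s) * q ^+ s); last by rewrite -exprD subnK // ltnW.
  by rewrite -!mul_polyC !polyCD !polyCN !polyCM; ring.
by rewrite -size_poly_eq1 size_polyC qpow_neq1 // subn_gt0.
Qed.

Lemma Lfac_neq0 l s : Lfac l s != 0.
Proof.
rewrite /Lfac; apply/negP; case: cs => [|q] /eqP e.
  have h x : 2 * x + (s%:R + pd l) = 0 by rewrite -(horner0 x) -e !hornerE.
  have /eqP : 2 = (2 * 1 + (s%:R + pd l)) - (2 * 0 + (s%:R + pd l)) by ring.
  by apply/negP; rewrite !h subrr pnatr_eq0.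
have := congr1 (horner^~ 0) e.
rewrite hornerD hornerN hornerZ hornerXn hornerC expr0n mulr0 subr0 horner0.
by apply/eqP; rewrite oner_eq0.
Qed.

(** The part of eta(x+k) - eta(x+j) that does not depend on x; see [eta_diff]. *)
Definition eta_cst j k : K :=
  match cs with Racah => k%:R - j%:R | QRacah q => q ^- k - q ^- j end.

Lemma eta_diff l j k u : coord cs u ->
  eta cs l (cadd cs u k) - eta cs l (cadd cs u j)
  = eta_cst j k / (weight cs).[u] * (Lfac l (j + k)).[u].
Proof.
rewrite /eta_cst /weight /Lfac; move: hcs; case: l => a b c d; case: cs => [|q] /= v cu.
  by rewrite hornerC divr1 !hornerE natrD /=; ring.
rewrite hornerX hornerD hornerN hornerZ hornerXn hornerC exprD.
have qk : q ^+ k != 0 by rewrite expf_neq0 // qcase_neq0.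
have qj : q ^+ j != 0 by rewrite expf_neq0 // qcase_neq0.
by field; rewrite qk qj cu.
Qed.

Lemma eta_cst_neq0 j k : (j < k)%N -> eta_cst j k != 0.
Proof.
rewrite /eta_cst; move: hcs; case: cs => [|q] v jk.
  by rewrite subr_eq0 eqr_nat gtn_eqF.
have q0 := qcase_neq0 v.
have -> : q ^- k - q ^- j = (1 - q ^+ (k - j)) / q ^+ k.
  by rewrite -{1 3}(subnK (ltnW jk)) exprD; field; rewrite !expf_neq0.
by rewrite mulf_neq0 ?invr_eq0 ?expf_neq0 // qpow_neq1 // subn_gt0.
Qed.

End Factors.

(** * Congruence and reflection of the row multipliers *)

Section RowFactors.

Variables (K : numFieldType) (cs : racah_case K).
Hypothesis hcs : valid_case cs.
Implicit Types (l : params K) (u y z : K) (i j k s t M B : nat).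

Lemma reg_cadd_inv j : regular cs (fun u => (weight cs).[cadd cs u j]^-1).
Proof.
have := reg_inv cs; rewrite /weight; case: cs => [|q] /= ri.
  by apply: reg_ext (reg_cst _ 1) => u _; rewrite hornerC invr1.
apply: reg_ext (regM ri (reg_cst _ (q ^- j))) => u cu.
by rewrite !hornerX invfM.
Qed.

Lemma reg_cadd_comp f j : regular cs f -> regular cs (fun u => f (cadd cs u j)).
Proof.
apply: reg_comp; [by move=> u; exact: coord_cadd|exact: reg_cadd|exact: reg_cadd_inv].
Qed.

Lemma reg_Vfac l : regular cs (Vfac cs l).
Proof.
have := reg_inv cs; rewrite /weight; case: l => a b c d; case: cs => [|q] /= ri.
  by apply: regM; apply: regD (reg_id _) (reg_cst _ _).
apply: regM; last by apply: reg_ext ri => u _; rewrite hornerX.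
apply: regM (reg_cst _ _); apply: regM.
  exact: regB (reg_cst _ _) (regM (reg_cst _ _) (reg_id _)).
exact: regB (reg_cst _ _) (regM (reg_cst _ _) (reg_id _)).
Qed.

Lemma reg_Wfac l : regular cs (Wfac cs l).
Proof.
have := reg_inv cs; rewrite /weight; case: l => a b c d; case: cs => [|q] /= ri.
  by apply: regM; apply: regD (regD (reg_id _) (reg_cst _ _)) (reg_cst _ _).
apply: regM; last by apply: reg_ext ri => u _; rewrite hornerX.
apply: regM.
  exact: regB (reg_cst _ _) (regM (reg_cst _ _) (reg_id _)).
exact: regB (reg_cst _ _) (regM (reg_cst _ _) (reg_id _)).
Qed.

(** Where [Lfac l (s + t)] vanishes, x + s is the reflection of x + t, and V at a reflected point is
    W. The proof gives the quotient explicitly. *)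
Lemma Vfac_congr l B s t : good cs l B ->
  reg_congr cs (Lfac cs l (s + t)) (fun u => Vfac cs l (cadd cs u s))
    (fun u => Wfac cs l (cadd cs u t)).
Proof.
move: hcs (reg_inv cs) => v; rewrite /weight /Lfac.
case: l => a b c d; move: v; case: cs => [|q] /= v ri g.
  exists (fun u => 2 * (u + s%:R) + a + b - (2 * u + (s%:R + t%:R + d))).
    apply: regB; last exact: regD (regM (reg_cst _ _) (reg_id _)) (reg_cst _ _).
    apply: regD (reg_cst _ _); apply: regD (reg_cst _ _).
    exact: regM (reg_cst _ _) (regD (reg_id _) (reg_cst _ _)).
  by move=> u _; rewrite !hornerE natrD /=; ring.
have {}ri : regular (QRacah q) (fun u => u^-1).
  by apply: reg_ext ri => u _; rewrite hornerX.
have q0 := qcase_neq0 v.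
exists (fun u => (d / (a * b) * q ^- s - q ^- t) * u^-1).
  exact: regM (reg_cst _ _) ri.
move=> u un0; rewrite hornerD hornerN hornerZ hornerXn hornerC exprD.
have qs : q ^+ s != 0 by rewrite expf_neq0.
have qt : q ^+ t != 0 by rewrite expf_neq0.
by field; rewrite un0 qs qt (gq_a0 g) (gq_b0 g).
Qed.

Lemma Vfac_refl l B y : good cs l B -> coord cs y ->
  Vfac cs l (refl cs (pd l) y) = Wfac cs l y.
Proof.
rewrite /refl; case: l => a b c d; case: cs => [|q] /= g cy; first by ring.
by field; rewrite (gq_a0 g) (gq_b0 g) (gq_d0 g) cy.
Qed.

Lemma Wfac_refl l B y : good cs l B -> coord cs y ->
  Wfac cs l (refl cs (pd l) y) = Vfac cs l y.
Proof.
rewrite /refl; case: l => a b c d; case: cs => [|q] /= g cy; first by ring.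
by field; rewrite (gq_a0 g) (gq_b0 g) (gq_d0 g) cy.
Qed.

(** In the Racah case, -x - (d + M) + i = -(x + M - i) - d. Thus the reflection for lambda + M delta
    reverses the nodes x, ..., x + M, up to the reflection for lambda, which fixes eta. *)
Lemma cadd_refl l M B i u : good cs l B -> coord cs u -> (i <= M)%N ->
  cadd cs (refl cs (pd (shift cs l M)) u) i = refl cs (pd l) (cadd cs u (M - i)).
Proof.
move: hcs; rewrite /refl; case: l => a b c d; case: cs => [|q] /= v g cu iM.
  by rewrite natrB //; ring.
have q0 := qcase_neq0 v.
have -> : q ^+ M = q ^+ (M - i) * q ^+ i by rewrite -exprD subnK.
by field; rewrite (gq_d0 g) cu !expf_neq0.
Qed.

Lemma eta_cadd_refl l M B i u : good cs l B -> coord cs u -> (i <= M)%N ->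
  eta cs l (cadd cs (refl cs (pd (shift cs l M)) u) i) = eta cs l (cadd cs u (M - i)).
Proof.
move=> g cu iM; rewrite (cadd_refl g) // eta_refl //; first exact: coord_pd g.
exact: coord_cadd.
Qed.

Definition VWprod l M i u : K :=
  (\prod_(0 <= t < i) Vfac cs l (cadd cs u t))
  * \prod_(i.+1 <= t < M.+1) Wfac cs l (cadd cs u t).

Lemma reg_VWprod l M i : regular cs (VWprod l M i).
Proof.
apply: regM; apply: reg_prod => t _; apply: reg_cadd_comp.
  exact: reg_Vfac.
exact: reg_Wfac.
Qed.

Lemma prod_nat_rev (F : nat -> K) M i : (i <= M)%N ->
  \prod_(0 <= t < i) F (M - t)%N = \prod_((M - i).+1 <= t < M.+1) F t.
Proof.
move=> iM; rewrite [RHS]big_nat_rev /= -{1}[(M - i).+1]add0n big_addn.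
have -> : (M.+1 - (M - i).+1)%N = i by lia.
rewrite !big_nat; apply: eq_bigr => t /andP[_ ti]; congr F; lia.
Qed.

(** The two products share the V-factors below j and the W-factors above k. In between, V at node t
    is congruent to W at node j + k - t. *)
Lemma VWprod_congr l B M j k : good cs l B -> (j < k)%N -> (k <= M)%N ->
  reg_congr cs (Lfac cs l (j + k)) (VWprod l M k) (VWprod l M j).
Proof.
move=> g jk kM.
have rV t : regular cs (fun u => Vfac cs l (cadd cs u t)).
  exact: reg_cadd_comp (reg_Vfac l).
have rW t : regular cs (fun u => Wfac cs l (cadd cs u t)).
  exact: reg_cadd_comp (reg_Wfac l).
pose F u := \prod_(0 <= t < j) Vfac cs l (cadd cs u t).
pose G u := \prod_(k.+1 <= t < M.+1) Wfac cs l (cadd cs u t).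
have rF : regular cs F by apply: reg_prod.
have rG : regular cs G by apply: reg_prod.
have [h rh hE] : reg_congr cs (Lfac cs l (j + k))
    (fun u => \prod_(j <= t < k) Vfac cs l (cadd cs u t))
    (fun u => \prod_(j <= t < k) Wfac cs l (cadd cs u (j + k - t))).
  apply: reg_congr_prod => // t; rewrite mem_index_iota => /andP[jt tk].
  have {1}-> : (j + k = t + (j + k - t))%N by lia.
  exact: Vfac_congr g.
exists (fun u => F u * h u * G u); first exact: regM (regM rF rh) rG.
move=> u cu; have := hE u cu.
have -> : \prod_(j <= t < k) Wfac cs l (cadd cs u (j + k - t))
  = \prod_(j.+1 <= t < k.+1) Wfac cs l (cadd cs u t).
  rewrite big_add1 /= [RHS]big_nat_rev /= !big_nat; apply: eq_bigr => t /andP[jt tk].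
  by congr (Wfac _ _ (cadd _ _ _)); lia.
rewrite /VWprod (@big_cat_nat _ _ _ j 0 k) //=; last exact: ltnW.
rewrite (@big_cat_nat _ _ _ k.+1 j.+1 M.+1) //=; last exact: ltnW.
rewrite -/(F u) -/(G u); move: (F u) (G u) => x y hu.
rewrite mulrA -mulrBl -mulrBr hu; ring.
Qed.

Lemma VWprod_refl l B M i u : good cs l B -> coord cs u -> (i <= M)%N ->
  VWprod l M i (refl cs (pd (shift cs l M)) u) = VWprod l M (M - i) u.
Proof.
move=> g cu iM; rewrite /VWprod mulrC; congr (_ * _).
  rewrite -{1}(subKn iM) -(@prod_nat_rev (fun t => Wfac cs l (cadd cs (refl _ _ u) t))) ?leq_subr //.
  rewrite !big_nat; apply: eq_bigr => t /andP[_ tM].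
  rewrite (cadd_refl g) ?leq_subr // subKn; last by lia.
  by rewrite (Wfac_refl g) //; apply: coord_cadd.
rewrite -(@prod_nat_rev (fun t => Wfac cs l (cadd cs u t))) //.
rewrite !big_nat; apply: eq_bigr => t /andP[_ tM].
rewrite (cadd_refl g) //; last by lia.
by rewrite (Vfac_refl g) //; apply: coord_cadd.
Qed.

(** The denominators y of [Vfac] and [Wfac] run over all nodes but the i-th; the power q^i makes
    their product independent of i. *)
Lemma qpow_prod q i M u : u != 0 -> (i <= M)%N ->
  q ^+ i * (\prod_(0 <= t < i) (u * q ^+ t)) * \prod_(i.+1 <= t < M.+1) (u * q ^+ t)
  = u ^+ M * \prod_(0 <= t < M) q ^+ t.+1.
Proof.
move=> un0 iM.
have -> : q ^+ i * (\prod_(0 <= t < i) (u * q ^+ t)) = \prod_(0 <= t < i) (u * q ^+ t.+1).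
  under [RHS]eq_bigr do rewrite exprSr mulrA.
  by rewrite [RHS]big_split /= prodr_const_nat subn0 mulrC.
rewrite big_add1 /= -(@big_cat_nat _ _ _ i 0 M) //= big_split /=.
by rewrite prodr_const_nat subn0.
Qed.

Lemma rfactorE l B M : good cs l B -> exists e : K, forall i u,
  coord cs u -> (i <= M)%N -> rfactor cs l M i u = e * VWprod l M i u.
Proof.
move: hcs; rewrite /VWprod; case: l => a b c d; case: cs => [|q] /= v g.
  exists (pochs Racah [:: d - a + 1; d - b + 1] M)^-1 => i u _ iM.
  rewrite [RHS]mulrC; congr (_ * _).
  rewrite -{3}[i.+1]add0n big_addn subSS.
  rewrite /pochs !big_cons !big_nil !mulr1 /poch -!big_split /=.
  rewrite !big_mkord; congr (_ * _); apply: eq_bigr => t _; first by ring.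
  by rewrite natrD; ring.
have q0 := qcase_neq0 v.
set D := pochs _ _ M.
exists ((\prod_(0 <= t < M) q ^+ t.+1) / D) => i u un0 iM.
have e := qpow_prod q un0 iM.
have un q' : q' != 0 -> \prod_(0 <= t < i) (u * q' ^+ t) != 0.
  move=> q'0; rewrite prodf_seq_neq0; apply/allP => t _.
  by rewrite mulf_neq0 // expf_neq0.
have un' : \prod_(i.+1 <= t < M.+1) (u * q ^+ t) != 0.
  rewrite prodf_seq_neq0; apply/allP => t _.
  by rewrite mulf_neq0 // expf_neq0.
have [w wE] : exists w, d / (a * b) = w by exists (d / (a * b)).
rewrite wE.
rewrite !big_split /= !prodfV prodr_const_nat subn0.
have pE z : poch (QRacah q) (z * u) i = \prod_(0 <= t < i) (1 - z * (u * q ^+ t)).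
  by rewrite /poch big_mkord; apply: eq_bigr => t _; rewrite mulrA.
have pE' z : poch (QRacah q) (z * (u * q ^+ i.+1)) (M - i)
    = \prod_(i.+1 <= t < M.+1) (1 - z * (u * q ^+ t)).
  rewrite -{2}[i.+1]add0n big_addn subSS /poch big_mkord.
  by apply: eq_bigr => t _; rewrite exprD -!mulrA [q ^+ i.+1 * _]mulrC.
rewrite [pochs _ [:: a * u; _] _]/pochs [pochs _ [:: _ * _ * _; _] _]/pochs.
rewrite !big_cons !big_nil !mulr1 !pE !pE'.
have [a0 b0 d0] : [/\ a != 0, b != 0 & d != 0].
  by rewrite (gq_a0 g) (gq_b0 g) (gq_d0 g).
(* The factor d/(ab) in [Vfac] accounts for the powers of a b d^-1 q^-1 in [rfactor]; the surplus
   q^-i is the power that [qpow_prod] absorbs. *)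
have -> : w ^+ i = ((a * b * d^-1 * q^-1) ^+ i)^-1 / q ^+ i.
  by rewrite -!exprVn -exprMn; congr (_ ^+ _); rewrite -wE; field; rewrite a0 b0 d0 q0.
have -> : \prod_(0 <= t < M) q ^+ t.+1
   = u ^- M * (u ^+ M * \prod_(0 <= t < M) q ^+ t.+1) by rewrite mulKf ?expf_neq0.
rewrite -e [((a * b * d^-1 * q^-1) ^+ i * _ * _)^-1]invfM [((a * b * d^-1 * q^-1) ^+ i * _)^-1]invfM.
move: (\prod_(0 <= t < i) (u * q ^+ t)) (\prod_(i.+1 <= t < M.+1) (u * q ^+ t)) un' (un q q0).
move=> y z z0 y0; move: (_ ^+ i)^-1 => x.
have qi : q ^+ i != 0 by rewrite expf_neq0.
have uM : u ^+ M != 0 by rewrite expf_neq0.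
move: (D^-1) => D'; clear -qi uM z0 y0.
by field; rewrite qi uM z0 y0.
Qed.

End RowFactors.

(** * Multi-indexed polynomials *)

Lemma prod_lt_exchange (R : comNzRingType) m (F : nat -> nat -> R) :
  \prod_(k < m) \prod_(j < k) F j k = \prod_(i < m) \prod_(j < m | (i < j)%N) F i j.
Proof.
rewrite [RHS](exchange_big_dep predT) //=; apply: eq_bigr => k _.
by rewrite (big_ord_widen m (fun j => F j k)) // ltnW.
Qed.

(** The sign of the reversal is never computed: it appears in both the determinant and phi, and
    cancels in [PDcheck]. *)
Lemma det_rev (R : comNzRingType) n (A : 'M[R]_n) :
  \det (\matrix_(i, j) A (rev_ord i) j)
  = (-1) ^+ perm (@rev_ord_inj n) * \det A.
Proof.
rewrite -det_perm -det_mulmx -row_permE; congr (\det _).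
by apply/matrixP => i j; rewrite !mxE permE.
Qed.

Section MultiIndexed.

Variables (K : numFieldType) (cs : racah_case K).
Hypothesis hcs : valid_case cs.
Implicit Types (l : params K) (u y z : K) (i j k s t M B : nat).

(** Makes x = 0, 1, 2, ... admissible for evaluation: the conditions on d exclude 2 x + s + d = 0,
    resp. d q^(2x+s) = 1. *)
Lemma Lfac_cnat l B s x : good cs l B -> (Lfac cs l s).[cnat cs x] != 0.
Proof.
rewrite /Lfac; case: l => a b c d; case: cs => [|q] /= g.
  have := gr_d g (x.*2 + s)%N; rewrite natrD -mul2n natrM !hornerE /=.
  by congr (_ != 0); ring.
rewrite hornerD hornerN hornerZ hornerXn hornerC.
by have := gq_d g (s + x * 2)%N; rewrite exprD exprM mulrA.
Qed.

Lemma Lfac_shift l M s : Lfac cs (shift cs l M) s = Lfac cs l (M + s).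
Proof.
rewrite /Lfac; case: l => a b c d; case: cs => [|q] /=.
  by rewrite natrD; congr (_ + _%:P); ring.
by rewrite exprD mulrA.
Qed.

Lemma cadd_cnat x j : cadd cs (cnat cs x) j = cnat cs (x + j).
Proof. by case: cs => [|q] /=; rewrite ?natrD ?exprD. Qed.

Lemma eta_cnat_diff l B M j k : good cs l B -> (j < k)%N ->
  eta cs (shift cs l M) (cnat cs k) - eta cs (shift cs l M) (cnat cs j) != 0.
Proof.
move=> g jk; rewrite -[k]add0n -[j]add0n -!cadd_cnat eta_diff //.
  rewrite mulf_neq0 // ?Lfac_shift ?(Lfac_cnat _ _ g) // mulf_neq0 //.
    exact: eta_cst_neq0.
  by rewrite invr_eq0 weight_neq0 //; apply: coord_cnat.
exact: coord_cnat.
Qed.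

Lemma shift0 l : shift cs l 0 = l.
Proof. by case: l => a b c d; case: cs => [|q] /=; rewrite ?addr0 ?mulr1. Qed.

Lemma eta_cnat0 l : eta cs l (cnat cs 0) = 0.
Proof. by case: l => a b c d; case: cs => [|q] /=; rewrite ?mul0r // invr1 subrr mul0r. Qed.

Lemma eta_cnat_neq0 l B k : good cs l B -> (0 < k)%N -> eta cs l (cnat cs k) != 0.
Proof.
by move=> g k0; have := eta_cnat_diff 0 g k0; rewrite shift0 eta_cnat0 subr0.
Qed.

Lemma eta_poly_eq0 l B M (p : {poly K}) : good cs l B ->
  (forall j, p.[eta cs (shift cs l M) (cnat cs j)] = 0) -> p = 0.
Proof.
move=> g p0; apply/eqP; case: (boolP (p == 0)) => // pn0.
pose f j := eta cs (shift cs l M) (cnat cs j).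
have := @max_poly_roots K p [seq f j | j <- iota 0 (size p)] pn0.
rewrite size_map size_iota ltnn => -> //.
  by apply/allP => x /mapP[j _ ->]; rewrite rootE p0.
rewrite map_inj_uniq ?iota_uniq // => i j /eqP; rewrite -subr_eq0 /f => fij.
case: (ltngtP i j) => // ij; last by move: fij; rewrite (negPf (eta_cnat_diff M g ij)).
by move: fij; rewrite -oppr_eq0 opprB (negPf (eta_cnat_diff M g ij)).
Qed.

Definition Lprod l M u := \prod_(k < M) \prod_(j < k) (Lfac cs l (j + k)).[u].

(** The nowhere vanishing part of phi, inverted: phi is [Lprod] divided by it. *)
Definition phi_unit l M u : K :=
  \prod_(k < M) \prod_(j < k)
    ((weight cs).[u] * eta cs l (cnat cs (k - j)) / eta_cst cs j k).

Lemma reg_phi_unit l M : regular cs (phi_unit l M).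
Proof.
apply: reg_prod => k _; apply: reg_prod => j _.
exact: regM (regM (reg_poly cs _) (reg_cst _ _)) (reg_cst _ _).
Qed.

Lemma phi_unit_neq0 l B M u : good cs l B -> coord cs u -> phi_unit l M u != 0.
Proof.
move=> g cu; apply/prodf_neq0 => k _; apply/prodf_neq0 => j _.
rewrite !mulf_neq0 ?invr_eq0 ?weight_neq0 ?eta_cst_neq0 //.
by rewrite (eta_cnat_neq0 g) // subn_gt0.
Qed.

Lemma phiE l B M u : good cs l B -> coord cs u ->
  phi cs l M u = Lprod l M u / phi_unit l M u.
Proof.
move=> g cu; rewrite -prodf_div; apply: eq_bigr => k _.
rewrite -prodf_div; apply: eq_bigr => j _; rewrite eta_diff //.
have := weight_neq0 cu; have := eta_cst_neq0 hcs (ltn_ord j).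
have : eta cs l (cnat cs (k - j)) != 0 by rewrite (eta_cnat_neq0 g) // subn_gt0.
by move: (eta _ _ _) (eta_cst _ _ _) (_.[u]) => x y z x0 y0 z0; field; rewrite x0 y0 z0.
Qed.

Lemma Lprod_poly l M : exists2 Z : {poly K}, Z != 0 & forall u, Z.[u] = Lprod l M u.
Proof.
exists (\prod_(k < M) \prod_(j < k) Lfac cs l (j + k)).
  apply/prodf_neq0 => k _; apply/prodf_neq0 => j _; exact: Lfac_neq0.
move=> u; rewrite horner_prod; apply: eq_bigr => k _.
by rewrite horner_prod.
Qed.

Lemma phi_cnat_neq0 l B M x : good cs l B -> phi cs l M (cnat cs x) != 0.
Proof.
move=> g; rewrite (phiE _ g); last exact: coord_cnat.
rewrite mulf_neq0 ?invr_eq0 ?(phi_unit_neq0 _ g) //; last exact: coord_cnat.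
by apply/prodf_neq0 => k _; apply/prodf_neq0 => j _; apply: Lfac_cnat g.
Qed.

(** Up to a constant, phi_{M+1} is the Vandermonde determinant of the eta(x+i), whose rows the
    reflection reverses. *)
Lemma phi_refl l B M u : good cs l B -> coord cs u ->
  phi cs l M.+1 (refl cs (pd (shift cs l M)) u)
  = (-1) ^+ perm (@rev_ord_inj M.+1) * phi cs l M.+1 u.
Proof.
move=> g cu.
pose V u := Vandermonde M.+1 (\row_(i < M.+1) eta cs l (cadd cs u i)).
pose e := \prod_(k < M.+1) \prod_(j < k) (eta cs l (cnat cs (k - j)))^-1.
have pE v : phi cs l M.+1 v = \det (V v)^T * e.
  rewrite det_tr det_Vandermonde.
  under eq_bigr do under eq_bigr do rewrite !mxE.
  rewrite -(prod_lt_exchange M.+1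
    (fun j k => eta cs l (cadd cs v k) - eta cs l (cadd cs v j))).
  rewrite -big_split; apply: eq_bigr => k _.
  by rewrite -big_split; apply: eq_bigr => j _.
rewrite !pE mulrA -det_rev; congr (\det _ * _).
apply/matrixP => i j; rewrite !mxE (eta_cadd_refl hcs g) //; last by rewrite -ltnS.
Qed.

Definition PDmx l M (D : M.-tuple nat) n u : 'M[K]_M.+1 :=
  \matrix_(i < M.+1, j < M.+1)
      if (j < M)%N then Pcheck cs (twist cs l) (nth 0%N D j) (cadd cs u i)
      else rfactor cs l M i u * Pcheck cs l n (cadd cs u i).

Lemma eta_twist l u : eta cs (twist cs l) u = eta cs l u.
Proof. by case: l => a b c d; case: cs. Qed.

(** This form shows congruences and reflection at once. The twist keeps d, hence eta, so all columns
    are polynomials in the same eta(x+i), up to the multiplier of the last one. *)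
Lemma PDmx_entry l B M (D : M.-tuple nat) n : good cs l B ->
  exists (p : 'I_M.+1 -> {poly K}) (e : K), forall u, coord cs u ->
  forall i j : 'I_M.+1, PDmx l D n u i j = (p j).[eta cs l (cadd cs u i)]
     * (if (j < M)%N then 1 else e * VWprod cs l M i u).
Proof.
move=> g; have [e eE] := rfactorE hcs M g.
have /fin_all_exists [p pE] (j : 'I_M.+1) : exists p : {poly K},
    forall y, coord cs y -> p.[eta cs l y] =
      if (j < M)%N then Pcheck cs (twist cs l) (nth 0%N D j) y else Pcheck cs l n y.
  case: (j < M)%N.
    have [p pE] := Pcheck_poly (twist cs l) (nth 0%N D j) hcs.
    by exists p => y cy; rewrite pE ?eta_twist.
  by have [p pE] := Pcheck_poly l n hcs; exists p => y cy; rewrite pE.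
exists p, e => u cu i j; rewrite mxE pE; last exact: coord_cadd.
case: ifP => _; first by rewrite mulr1.
have iM : (i <= M)%N by rewrite -ltnS.
by rewrite (eE i u cu iM); apply: mulrC.
Qed.

Lemma reg_eta_cadd l i : regular cs (fun u => eta cs l (cadd cs u i)).
Proof. exact: reg_cadd_comp (reg_eta cs l). Qed.

Lemma PDmx_det_dvd l B M (D : M.-tuple nat) n : good cs l B ->
  exists2 g, regular cs g &
    eq_coord cs (fun u => \det (PDmx l D n u)) (fun u => Lprod l M.+1 u * g u).
Proof.
move=> g; have [p [e pE]] := PDmx_entry D n g.
have rR (i j : 'I_M.+1) : regular cs
    (fun u => if (j < M)%N then 1 else e * VWprod cs l M i u).
  case: (j < M)%N; first exact: reg_cst.
  by apply: regM (reg_cst _ _) _; apply: reg_VWprod.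
have rp (i j : 'I_M.+1) : regular cs (fun u => (p j).[eta cs l (cadd cs u i)]).
  by apply: reg_horner; apply: reg_eta_cadd.
apply: reg_det_dvd.
- exact: Lfac_weight.
- by move=> s t; apply: (Lfac_coprime hcs g).
- move=> i c; apply: reg_ext (regM (rp i c) (rR i c)) => u cu; exact: pE.
move=> j k c jk.
have cE : reg_congr cs (Lfac cs l (j + k))
    (fun u => eta cs l (cadd cs u k)) (fun u => eta cs l (cadd cs u j)).
  exists (fun u => eta_cst cs j k * (weight cs).[u]^-1).
    exact: regM (reg_cst _ _) (reg_inv _).
  by move=> u cu; rewrite eta_diff // mulrC.
have cR : reg_congr cs (Lfac cs l (j + k))
    (fun u => if (c < M)%N then 1 else e * VWprod cs l M k u)
    (fun u => if (c < M)%N then 1 else e * VWprod cs l M j u).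
  case: (c < M)%N; first exact: reg_congr_refl.
  apply: reg_congrM (reg_congr_refl _ _ _) (VWprod_congr hcs g jk _).
  - exact: reg_cst.
  - exact: reg_VWprod.
  by rewrite -ltnS.
have cP := reg_congr_horner (p c) (reg_eta_cadd l k) (reg_eta_cadd l j) cE.
have [h rh hE] := reg_congrM (rp j c) (rR k c) cP cR.
by exists h => // u cu; rewrite !pE // hE.
Qed.

Lemma PDcheckE l M (D : M.-tuple nat) n u : PDcheck cs l D n u =
  (normCDn cs l D n%:Z)^-1 * (phi cs l M.+1 u)^-1 * \det (PDmx l D n u).
Proof. by []. Qed.

Lemma PDmx_refl l B M (D : M.-tuple nat) n u : good cs l B -> coord cs u ->
  \det (PDmx l D n (refl cs (pd (shift cs l M)) u))
  = (-1) ^+ perm (@rev_ord_inj M.+1) * \det (PDmx l D n u).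
Proof.
move=> g cu; rewrite -det_rev; congr (\det _); apply/matrixP => i j.
have [p [e pE]] := PDmx_entry D n g.
have iM : (i <= M)%N by rewrite -ltnS.
rewrite [RHS]mxE !pE //; last by apply: coord_refl => //; exact: coord_pd_shift g.
rewrite (eta_cadd_refl hcs g) //= subSS; congr (_ * _).
by case: ifP => // _; rewrite (VWprod_refl hcs g).
Qed.

Lemma PDcheck_refl l B M (D : M.-tuple nat) n u : good cs l B -> coord cs u ->
  PDcheck cs l D n (refl cs (pd (shift cs l M)) u) = PDcheck cs l D n u.
Proof.
move=> g cu; rewrite !PDcheckE (phi_refl _ g) // (PDmx_refl _ _ g) //.
have : (-1) ^+ perm (@rev_ord_inj M.+1) != 0 :> K by rewrite signr_eq0.
move: (_ ^+ _) (phi _ _ _ _) (\det _) (normCDn _ _ _ _)^-1 => e x y z e0; rewrite invfM.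
by move: x^-1 => x'; field.
Qed.

End MultiIndexed.

(** * Values of the chosen polynomials, and nonvanishing of the constants *)

Section Evaluation.

Variables (K : numFieldType) (cs : racah_case K).
Hypothesis hcs : valid_case cs.
Implicit Types (l : params K) (u y z : K) (i j s t M B : nat).

Lemma poly_in_etaP l (dom : K -> Prop) (f : K -> K) :
  (exists p : {poly K}, forall u, dom u -> p.[eta cs l u] = f u) ->
  forall u, dom u -> (poly_in_eta cs l dom f).[eta cs l u] = f u.
Proof. exact: epsilon_spec. Qed.

Lemma PD_eval l B M (D : M.-tuple nat) (n : nat) u : good cs l B ->
  coord cs u -> phi cs l M.+1 u != 0 ->
  (PD cs l D n%:Z).[eta cs (shift cs l M) u] = PDcheck cs l D n u.
Proof.
move=> g cu phin0; apply: poly_in_etaP; last by split.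
have [r rr rE] := PDmx_det_dvd hcs D n g.
(* [PDcheck] with [Lprod] cancelled: regular on all coordinates, also at the zeros of phi. *)
pose G v := (normCDn cs l D n%:Z)^-1 * phi_unit cs l M.+1 v * r v.
have GE v : coord cs v -> phi cs l M.+1 v != 0 -> G v = PDcheck cs l D n v.
  move=> cv; rewrite (phiE hcs _ g) // mulf_eq0 negb_or => /andP[Ln0 _].
  rewrite PDcheckE rE // (phiE hcs _ g) // /G invf_div.
  by move: (normCDn _ _ _ _)^-1 (phi_unit _ _ _ _) => x y; field.
have [Z Zn0 ZE] := Lprod_poly cs l M.+1.
have rG : regular cs G by apply: regM rr; apply: regM (reg_cst _ _) (reg_phi_unit _ _ _).
have cD := coord_pd_shift hcs M g.
have [v cv Zv|h hE] := sym_poly cD Zn0 rG.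
  have phiv : phi cs l M.+1 v != 0.
    by rewrite (phiE hcs _ g) // -ZE mulf_neq0 ?invr_eq0 ?(phi_unit_neq0 hcs _ g).
  rewrite !GE ?(PDcheck_refl hcs _ _ g) //; first exact: coord_refl.
  by rewrite (phi_refl hcs _ g) // mulf_neq0 ?signr_eq0.
by exists h => v [cv pv]; rewrite hE // GE.
Qed.

Lemma reg_Rcheck l t n k : regular cs (Rcheck cs l t n k).
Proof.
elim: t n k => [|t IHt] n k /=.
  by case: (_ || _); apply: reg_cst.
case: (_ || _); first exact: reg_cst.
apply: regD; first apply: regD; apply: regM => //; try exact: reg_cst.
exact: regB (reg_cst _ _) (reg_eta_cadd hcs _ _).
Qed.

Lemma Rpoly_eval l B s (n k : int) u : good cs l B -> coord cs u ->
  (Rpoly cs l s n k).[eta cs (shift cs l s) u] = Rcheck cs l s.+1 n k u.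
Proof.
move=> g cu; apply: poly_in_etaP => //.
have cD := coord_pd_shift hcs s g.
apply: (sym_poly cD (oner_neq0 _) (reg_Rcheck _ _ _ _)) => v cv _.
rewrite !RcheckE.
(* The reflection reverses the list of the eta(x+i), and the operators commute. *)
rewrite -[RHS]jacobi_iter_rev; apply: jacobi_iter_eq => i is_.
by rewrite (eta_cadd_refl hcs g).
Qed.

(** The energy differences factor, in the Racah case as E_n - E~_v = (c+n+v) (a+b-d-1+n-v) and E~_v
    - E~_w = (w-v) (a+b-c-d-1-v-w). This is the origin of the conditions [gr_ev] and [gr_vv];
    sortedness of [D] gives v < w. *)
Lemma normCDn_neq0 l B M (D : M.-tuple nat) (n : nat) : good cs l B ->
  sorted ltn D -> normCDn cs l D n%:Z != 0.
Proof.
move=> g sD.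
have Bn0 j : alpha cs l * Bprime cs l (cnat cs j) != 0.
  move: hcs g {sD D}; case: l => a b c d; case: cs => [|q] /= v g.
    rewrite mul1r oppr_eq0 !mulf_neq0 // ?invr_eq0 ?mulf_neq0 //.
    - by have := gr_da g j; congr (_ != 0); ring.
    - by have := gr_db g j; congr (_ != 0); ring.
    - by rewrite addrC (gr_c g).
    - by rewrite addrC (gr_d g).
    - by have := gr_d g (j + j); rewrite natrD; congr (_ != 0); ring.
    - by have := gr_d g (j + j + 1); rewrite !natrD; congr (_ != 0); ring.
  have q0 := qcase_neq0 v.
  have [a0 b0 d0] : [/\ a != 0, b != 0 & d != 0].
    by rewrite (gq_a0 g) (gq_b0 g) (gq_d0 g).
  have sc x y z : x != 0 -> x - d * y != 0 -> z = x^-1 * d * y -> 1 - z != 0.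
    move=> x0 xy ->; have -> : 1 - x^-1 * d * y = (x - d * y) / x by field.
    by rewrite mulf_neq0 ?invr_eq0.
  rewrite !mulf_neq0 ?invr_eq0 // oppr_eq0 !mulf_neq0 // ?invr_eq0 ?mulf_neq0 //.
  - by apply: (sc a (q ^+ j.+1)) => //; [exact: (gq_da g) | rewrite exprSr].
  - by apply: (sc b (q ^+ j.+1)) => //; [exact: (gq_db g) | rewrite exprSr].
  - exact: (gq_c g).
  - exact: (gq_d g).
  - by rewrite -exprM (gq_d g).
  - by rewrite -exprM -exprSr (gq_d g).
have En0 v : energy cs l n - venergy cs l v != 0.
  move: hcs g {sD D Bn0}; case: l => a b c d; case: cs => [|q] /= h g.
    have -> : n%:~R * (n%:~R + (a + b + c - d - 1))
        - - ((c + v%:R) * ((a + b + c - d - 1) - c - v%:R))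
      = (c + (n + v)%:R) * (a + b - d - 1 + n%:R - v%:R).
      by rewrite natrD; ring.
    by rewrite mulf_neq0 ?(gr_c g) ?(gr_ev g).
  have q0 := qcase_neq0 h.
  have [a0 b0 d0 c0] : [/\ a != 0, b != 0, d != 0 & c != 0].
    by rewrite (gq_a0 g) (gq_b0 g) (gq_d0 g) (gq_c0 g).
  have qn : q ^+ n != 0 by rewrite expf_neq0.
  have qv : q ^+ v != 0 by rewrite expf_neq0.
  have -> : (q ^ (- n%:Z) - 1) * (1 - a * b * c * d^-1 * q^-1 * q ^ n)
      - - ((1 - c * q ^+ v) * (1 - c^-1 * (a * b * c * d^-1 * q^-1) * q ^- v))
    = (q ^+ n)^-1 * (1 - c * q ^+ (n + v)) * (d * q * q ^+ v - a * b * q ^+ n)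
       / (d * q * q ^+ v).
    by rewrite -exprnN exprD -exprnP; field; rewrite c0 d0 q0 qn qv.
  by rewrite !mulf_neq0 ?invr_eq0 ?mulf_neq0 ?(gq_c g) ?(gq_ev g).
have Vn0 v w : (v < w)%N -> venergy cs l v - venergy cs l w != 0.
  move: hcs g {sD D Bn0 En0}; case: l => a b c d; case: cs => [|q] /= h g vw.
    have -> : - ((c + v%:R) * ((a + b + c - d - 1) - c - v%:R))
        - - ((c + w%:R) * ((a + b + c - d - 1) - c - w%:R))
      = (w%:R - v%:R) * (a + b - c - d - 1 - (v + w)%:R).
      by rewrite natrD; ring.
    by rewrite mulf_neq0 ?(gr_vv g) // subr_eq0 eqr_nat gtn_eqF.
  have q0 := qcase_neq0 h.
  have [a0 b0 d0 c0] : [/\ a != 0, b != 0, d != 0 & c != 0].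
    by rewrite (gq_a0 g) (gq_b0 g) (gq_d0 g) (gq_c0 g).
  have qw : q ^+ w = q ^+ v * q ^+ (w - v) by rewrite -exprD subnKC // ltnW.
  have qv : q ^+ v != 0 by rewrite expf_neq0.
  have qwv : q ^+ (w - v) != 0 by rewrite expf_neq0.
  have -> : - ((1 - c * q ^+ v) * (1 - c^-1 * (a * b * c * d^-1 * q^-1) * q ^- v))
      - - ((1 - c * q ^+ w) * (1 - c^-1 * (a * b * c * d^-1 * q^-1) * q ^- w))
    = (1 - q ^+ (w - v)) * (c * d * q * q ^+ (v + w) - a * b) / (d * q * q ^+ w).
    by rewrite exprD qw; field; rewrite c0 d0 q0 qv qwv.
  rewrite !mulf_neq0 ?invr_eq0 ?mulf_neq0 ?(gq_vv g) ?expf_neq0 //.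
  by rewrite qpow_neq1 // subn_gt0.
rewrite /normCDn /normCD !mulf_neq0 ?signr_eq0 ?invr_eq0 ?(phi_cnat_neq0 hcs _ _ g) //.
  apply/prodf_neq0 => k _; apply/prodf_neq0 => j jk.
  rewrite mulf_neq0 ?invr_eq0 // Vn0 // !(tnth_nth 0%N).
  by apply: (sorted_ltn_nth ltn_trans 0%N sD) => //; rewrite inE size_tuple.
by apply/prodf_neq0 => j _; rewrite mulf_neq0 ?invr_eq0.
Qed.

End Evaluation.

(** * Recurrence relations *)

(** Both sums run over m = n + k. For n <= M + 1 the left one may have extra negative indices;
    otherwise the right one has extra indices below the band. *)
Lemma sum_band (V : nmodType) (F : int -> V) (n M : nat) :
  (forall m, m < 0 -> F m = 0) -> (forall m, M.+1%:Z < `|m - n%:Z| -> F m = 0) ->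
  \sum_(i < (2 * M + 3)%N) F (n%:Z + (i%:Z - M.+1%:Z)) = \sum_(m < (n + M.+2)%N) F m%:Z.
Proof.
move=> Fneg Fout.
rewrite -(big_mkord predT (fun i => F (n%:Z + (i%:Z - M.+1%:Z)))).
rewrite -(big_mkord predT (fun m => F m%:Z)).
case: (leqP n M.+1) => nM.
  rewrite (@big_cat_nat _ _ _ (M.+1 - n)) //=; last by lia.
  rewrite big_nat big1 ?add0r; last by move=> i /andP[_ iM]; apply: Fneg; lia.
  rewrite -{1}[(M.+1 - n)%N]add0n big_addn.
  have -> : (2 * M + 3 - (M.+1 - n) = n + M.+2)%N by lia.
  by apply: eq_bigr => i _; congr F; lia.
rewrite [RHS](@big_cat_nat _ _ _ (n - M.+1)) //=; last by lia.
rewrite [X in _ = X + _]big_nat [X in _ = X + _]big1 ?add0r; last first.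
  by move=> i /andP[_ iM]; apply: Fout; lia.
rewrite -{1}[(n - M.+1)%N]add0n big_addn.
have -> : (n + M.+2 - (n - M.+1) = 2 * M + 3)%N by lia.
by apply: eq_bigr => i _; congr F; lia.
Qed.

Section Recurrence.

Variables (K : numFieldType) (cs : racah_case K).
Hypothesis hcs : valid_case cs.
Implicit Types (l : params K) (u y z : K) (i j s t M B : nat).

Lemma Rcheck_Pcheck_sum l B M n u y : good cs l B -> (n + M + 1 <= B)%N ->
  coord cs y ->
  \sum_(i < (2 * M + 3)%N)
     Rcheck cs l M.+1 n%:Z (i%:Z - M.+1%:Z) u
       * Pcheck_int cs l y (n%:Z + (i%:Z - M.+1%:Z))
  = (\prod_(i < M.+1) (eta cs l y - eta cs l (cadd cs u i))) * Pcheck cs l n y.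
Proof.
move=> g nB cy.
pose J m := jacobi_iter (coefA cs l) (coefB cs l) (coefC cs l)
  (fun i => eta cs l (cadd cs u i)) M.+1 (delta K m) n%:Z.
pose F m := J m * Pcheck_int cs l y m.
transitivity (\sum_(i < (2 * M + 3)%N) F (n%:Z + (i%:Z - M.+1%:Z))).
  by apply: eq_bigr => i _; rewrite RcheckE.
rewrite sum_band => [|m m0|m mout].
- have -> : (n + M.+2 = (n + M.+1).+1)%N by lia.
  apply: (@jacobi_iter_sum _ _ _ _ (fun i => eta cs l (cadd cs u i)) M.+1
    (eta cs l y) (Pcheck_int cs l y) (n + M.+1) n) => //; first exact: coefC0.
  by move=> k kn; apply: (Pcheck_rec hcs g) => //; lia.
- by rewrite /F /J jacobi_iter_neg ?mul0r.
- by rewrite /F /J jacobi_iter_band ?mul0r.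
Qed.

Lemma PDmx_det l M (D : M.-tuple nat) u : exists cof : 'I_M.+1 -> K,
  forall n, \det (PDmx cs l D n u) =
    \sum_(i < M.+1) cof i * (rfactor cs l M i u * Pcheck cs l n (cadd cs u i)).
Proof.
(* The cofactors of the last column do not involve n, so they may be taken at n = 0. *)
exists (fun i : 'I_M.+1 => cofactor (PDmx cs l D 0 u) i ord_max) => n.
rewrite (expand_det_col _ ord_max); apply: eq_bigr => i _.
rewrite mxE /= ltnn mulrC; congr (_ * _).
rewrite /cofactor; congr (_ * \det _); apply/matrixP => j k; rewrite !mxE.
have -> : lift ord_max k = k :> nat by rewrite /= /bump leqNgt ltn_ord.
by rewrite ltn_ord.
Qed.

Lemma recurrence_normP l B M (D : M.-tuple nat) n :
  good cs l B -> sorted ltn D -> (n + M + 1 <= B)%N -> recurrence_norm cs l D n.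
Proof.
move=> g sD nB; apply: (eta_poly_eq0 hcs (M := M) g) => x.
set u := cnat cs x.
have cu : coord cs u by apply: coord_cnat.
have pu : phi cs l M.+1 u != 0 by apply: phi_cnat_neq0 g.
have [cof detE] := PDmx_det l D u.
rewrite horner_sum.
pose S j := \sum_(i < (2 * M + 3)%N)
     Rcheck cs l M.+1 n%:Z (i%:Z - M.+1%:Z) u
       * Pcheck_int cs l (cadd cs u j) (n%:Z + (i%:Z - M.+1%:Z)).
(* The factor i = j of the product is zero. *)
have S0 (j : 'I_M.+1) : S j = 0.
  rewrite /S (Rcheck_Pcheck_sum _ g) //; last exact: coord_cadd.
  by rewrite (bigD1 j) //= subrr !mul0r.
transitivity ((phi cs l M.+1 u)^-1 *
    \sum_(j < M.+1) cof j * rfactor cs l M j u * S j); last first.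
  by rewrite big1 ?mulr0 // => j _; rewrite S0 mulr0.
under [in RHS]eq_bigr do rewrite mulr_sumr.
rewrite exchange_big mulr_sumr; apply: eq_bigr => i _; cbv zeta.
rewrite hornerZ hornerM (Rpoly_eval hcs _ _ _ g) //.
case: (n%:Z + _) => m; last first.
  rewrite /= horner0 !mulr0 big1 ?mulr0 // => j _; by rewrite !mulr0.
rewrite (PD_eval hcs _ _ g) // PDcheckE detE.
have := normCDn_neq0 hcs m g sD; move: (normCDn _ _ _ _) => w w0.
rewrite mulrCA -!mulrA mulVKf // !mulr_sumr; apply: eq_bigr => j _ /=; ring.
Qed.

(** The first form divided by the constant at n: only the energy product in [normCDn] depends on
    n. *)
Lemma recurrence_energyP l B M (D : M.-tuple nat) n :
  good cs l B -> sorted ltn D -> (n + M + 1 <= B)%N -> recurrence_energy cs l D n.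
Proof.
move=> g sD nB; have := recurrence_normP g sD nB.
rewrite /recurrence_norm /recurrence_energy /=.
have := normCDn_neq0 hcs n g sD; set w := normCDn cs l D n => w0.
move=> /(congr1 (fun p => w^-1 *: p)); rewrite scaler0 scaler_sumr => e.
rewrite -[RHS]e; apply: eq_bigr => i _; rewrite scalerA; congr (_ *: _).
move: w0; rewrite /w /normCDn; move: (n%:Z + _) => m.
set A := (-1) ^+ M * _ * _; rewrite mulf_eq0 negb_or !prodf_div => /andP[A0].
rewrite mulf_eq0 negb_or invr_eq0 => /andP[x0 y0].
by field; rewrite A0 x0 y0.
Qed.

End Recurrence.

(** * Genericity *)

Section Generic.

Variables (K : numFieldType) (k : nat).
Implicit Types (S T : k.-tuple K -> Prop) (p : {mpoly K[k]}).

Lemma generic_sub S T : (forall v, S v -> T v) -> generic S -> generic T.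
Proof. by move=> ST [F [F0 FS]]; exists F; split=> // v /FS /ST. Qed.

Lemma generic_all (I : countType) (S : I -> k.-tuple K -> Prop) :
  (forall i, generic (S i)) -> generic (fun v => forall i, S i v).
Proof.
move=> gS.
pose F i := proj1_sig (constructive_indefinite_description _ (gS i)).
have FP i : (forall j, F i j != 0) /\
    (forall v, (forall j, (F i j).@[tnth v] != 0) -> S i v).
  exact: proj2_sig (constructive_indefinite_description _ (gS i)).
exists (fun m => if unpickle m is Some ij then F ij.1 ij.2 else 1); split.
  by move=> m; case: (unpickle m) => [ij|]; [apply: (FP _).1 | exact: oner_neq0].
move=> v Fv i; apply: (FP i).2 => j.
by have := Fv (pickle (i, j)); rewrite pickleK.
Qed.

Lemma generic_and S T : generic S -> generic T -> generic (fun v => S v /\ T v).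
Proof.
move=> gS gT.
apply: (generic_sub (S := fun v => forall b : bool, if b then S v else T v)).
  by move=> v h; split; [apply: (h true) | apply: (h false)].
by apply: generic_all; case.
Qed.

(** A polynomial is shown to be nonzero by a point [w] where its value is nonzero. *)
Lemma generic_neq0 p (f : k.-tuple K -> K) (w : 'I_k -> K) :
  p.@[w] != 0 -> (forall v, p.@[tnth v] = f v) -> generic (fun v => f v != 0).
Proof.
move=> pw pf; exists (fun=> p); split=> [_|v /(_ 0%N)]; last by rewrite pf.
by apply: contraNneq pw => ->; rewrite meval0.
Qed.

(** The parameters are polynomials in k free ones, so that k = 4 with free a and k = 3 with constant
    a are treated together. [a0] is a value of a compatible with any b, c, d. *)
Variables (pA pB pC pD : {mpoly K[k]}) (a0 : K).
Hypothesis witness : forall b c d, exists w : 'I_k -> K,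
  [/\ pA.@[w] = a0, pB.@[w] = b, pC.@[w] = c & pD.@[w] = d].

Let mE := (mevalD, mevalN, mevalM, mevalC).

Lemma generic_good_racah B :
  (forall i, (i < B)%N -> exists w, pA.@[w] + i%:R != 0) ->
  generic (fun v => good Racah
    (Params pA.@[tnth v] pB.@[tnth v] pC.@[tnth v] pD.@[tnth v]) B).
Proof.
move=> hA.
have h1 : generic (fun v => forall i, (i < B)%N -> pA.@[tnth v] + i%:R != 0).
  apply: generic_all => i; case: (ltnP i B) => iB.
    have [w wP] := hA i iB.
    apply: (generic_sub (S := fun v => pA.@[tnth v] + i%:R != 0)) => //.
    by apply: (@generic_neq0 (pA + i%:R%:MP) _ w) => [|v]; rewrite !mE.
  exists (fun=> 1); split=> // _; exact: oner_neq0.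
(* From here to [h9] the witness makes the polynomial in question equal to 1. *)
have h2 : generic (fun v => forall i, pB.@[tnth v] + i%:R != 0).
  apply: generic_all => i; have [w [_ wb _ _]] := witness (1 - i%:R) 0 0.
  apply: (@generic_neq0 (pB + i%:R%:MP) _ w) => [|v]; rewrite !mE //.
  by rewrite wb subrK oner_neq0.
have h3 : generic (fun v => forall i, pC.@[tnth v] + i%:R != 0).
  apply: generic_all => i; have [w [_ _ wc _]] := witness 0 (1 - i%:R) 0.
  apply: (@generic_neq0 (pC + i%:R%:MP) _ w) => [|v]; rewrite !mE //.
  by rewrite wc subrK oner_neq0.
have h4 : generic (fun v => forall i, pD.@[tnth v] + i%:R != 0).
  apply: generic_all => i; have [w [_ _ _ wd]] := witness 0 0 (1 - i%:R).
  apply: (@generic_neq0 (pD + i%:R%:MP) _ w) => [|v]; rewrite !mE //.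
  by rewrite wd subrK oner_neq0.
have h5 : generic (fun v => forall i, pA.@[tnth v] + pB.@[tnth v] + pC.@[tnth v]
    - pD.@[tnth v] - 1 - 1 + i%:R != 0).
  apply: generic_all => i.
  have [w [wa wb wc wd]] := witness (1 - (a0 - 1 - 1 + i%:R)) 0 0.
  apply: (@generic_neq0 (pA + pB + pC - pD - 1%:MP - 1%:MP + i%:R%:MP) _ w) => [|v]; rewrite !mE //.
  by rewrite ?wa ?wb ?wc ?wd [X in X != 0](_ : _ = 1) ?oner_neq0 //; ring.
have h6 : generic (fun v => forall i, pD.@[tnth v] - pA.@[tnth v] + 1 + i%:R != 0).
  apply: generic_all => i; have [w [wa wb wc wd]] := witness 0 0 (a0 - i%:R).
  apply: (@generic_neq0 (pD - pA + 1%:MP + i%:R%:MP) _ w) => [|v]; rewrite !mE //.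
  by rewrite ?wa ?wb ?wc ?wd [X in X != 0](_ : _ = 1) ?oner_neq0 //; ring.
have h7 : generic (fun v => forall i, pD.@[tnth v] - pB.@[tnth v] + 1 + i%:R != 0).
  apply: generic_all => i; have [w [wa wb wc wd]] := witness i%:R 0 0.
  apply: (@generic_neq0 (pD - pB + 1%:MP + i%:R%:MP) _ w) => [|v]; rewrite !mE //.
  by rewrite ?wa ?wb ?wc ?wd [X in X != 0](_ : _ = 1) ?oner_neq0 //; ring.
have h8 : generic (fun v => forall i j,
    pA.@[tnth v] + pB.@[tnth v] - pD.@[tnth v] - 1 + i%:R - j%:R != 0).
  apply: generic_all => i; apply: generic_all => j.
  have [w [wa wb wc wd]] := witness (1 - (a0 - 1 + i%:R - j%:R)) 0 0.
  apply: (@generic_neq0 (pA + pB - pD - 1%:MP + i%:R%:MP - j%:R%:MP) _ w) => [|v]; rewrite !mE //.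
  by rewrite ?wa ?wb ?wc ?wd [X in X != 0](_ : _ = 1) ?oner_neq0 //; ring.
have h9 : generic (fun v => forall i,
    pA.@[tnth v] + pB.@[tnth v] - pC.@[tnth v] - pD.@[tnth v] - 1 - i%:R != 0).
  apply: generic_all => i.
  have [w [wa wb wc wd]] := witness (1 - (a0 - 1 - i%:R)) 0 0.
  apply: (@generic_neq0 (pA + pB - pC - pD - 1%:MP - i%:R%:MP) _ w) => [|v]; rewrite !mE //.
  by rewrite ?wa ?wb ?wc ?wd [X in X != 0](_ : _ = 1) ?oner_neq0 //; ring.
have := generic_and h1 (generic_and h2 (generic_and h3 (generic_and h4
  (generic_and h5 (generic_and h6 (generic_and h7 (generic_and h8 h9))))))).
by apply: generic_sub => v [? [? [? [? [? [? [? [? ?]]]]]]]]; constructor.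
Qed.

Lemma generic_good_qracah q B : valid_case (QRacah q) -> a0 != 0 ->
  (forall i, (i < B)%N -> exists w, 1 - pA.@[w] * q ^+ i != 0) ->
  generic (fun v => good (QRacah q)
    (Params pA.@[tnth v] pB.@[tnth v] pC.@[tnth v] pD.@[tnth v]) B).
Proof.
move=> vq a0n0 hA; have q0 := qcase_neq0 vq.
have qn i : q ^+ i != 0 by rewrite expf_neq0.
have h1 : generic (fun v => forall i, (i < B)%N -> 1 - pA.@[tnth v] * q ^+ i != 0).
  apply: generic_all => i; case: (ltnP i B) => iB.
    have [w wP] := hA i iB.
    apply: (generic_sub (S := fun v => 1 - pA.@[tnth v] * q ^+ i != 0)) => //.
    by apply: (@generic_neq0 (1%:MP - pA * (q ^+ i)%:MP) _ w) => [|v]; rewrite !mE.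
  exists (fun=> 1); split=> // _; exact: oner_neq0.
(* In [h2] to [h9] each condition is a difference of two terms; at the chosen point a zero parameter
   kills one term and the other is nonzero. *)
have [w1 [wa1 wb1 wc1 wd1]] := witness 1 1 1.
have [w0 [wa0 wb0 wc0 wd0]] := witness 0 0 0.
have [wq [waq wbq wcq wdq]] := witness 0 1 1.
have [wr [war wbr wcr wdr]] := witness 1 0 0.
have ha : generic (fun v => pA.@[tnth v] != 0).
  by apply: (@generic_neq0 pA _ w1); rewrite ?wa1.
have hb : generic (fun v => pB.@[tnth v] != 0).
  by apply: (@generic_neq0 pB _ w1); rewrite ?wb1 ?oner_neq0.
have hc : generic (fun v => pC.@[tnth v] != 0).
  by apply: (@generic_neq0 pC _ w1); rewrite ?wc1 ?oner_neq0.
have hd : generic (fun v => pD.@[tnth v] != 0).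
  by apply: (@generic_neq0 pD _ w1); rewrite ?wd1 ?oner_neq0.
have h2 : generic (fun v => forall i, 1 - pB.@[tnth v] * q ^+ i != 0).
  apply: generic_all => i; apply: (@generic_neq0 (1%:MP - pB * (q ^+ i)%:MP) _ w0) => [|v]; rewrite !mE //.
  by rewrite ?wb0 ?mul0r ?subr0 ?oner_neq0.
have h3 : generic (fun v => forall i, 1 - pC.@[tnth v] * q ^+ i != 0).
  apply: generic_all => i; apply: (@generic_neq0 (1%:MP - pC * (q ^+ i)%:MP) _ w0) => [|v]; rewrite !mE //.
  by rewrite ?wc0 ?mul0r ?subr0 ?oner_neq0.
have h4 : generic (fun v => forall i, 1 - pD.@[tnth v] * q ^+ i != 0).
  apply: generic_all => i; apply: (@generic_neq0 (1%:MP - pD * (q ^+ i)%:MP) _ w0) => [|v]; rewrite !mE //.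
  by rewrite ?wd0 ?mul0r ?subr0 ?oner_neq0.
have h5 : generic (fun v => forall i, pD.@[tnth v] * q ^+ 2
    - pA.@[tnth v] * pB.@[tnth v] * pC.@[tnth v] * q ^+ i != 0).
  apply: generic_all => i.
  apply: (@generic_neq0 (pD * (q ^+ 2)%:MP - pA * pB * pC * (q ^+ i)%:MP) _ wq) => [|v]; rewrite !mE //.
  by rewrite ?waq ?wbq ?wcq ?wdq mulr0 !mul0r subr0 mul1r.
have h6 : generic (fun v => forall i, pA.@[tnth v] - pD.@[tnth v] * q ^+ i.+1 != 0).
  apply: generic_all => i; apply: (@generic_neq0 (pA - pD * (q ^+ i.+1)%:MP) _ w0) => [|v]; rewrite !mE //.
  by rewrite ?wa0 ?wd0 mul0r subr0.
have h7 : generic (fun v => forall i, pB.@[tnth v] - pD.@[tnth v] * q ^+ i.+1 != 0).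
  apply: generic_all => i; apply: (@generic_neq0 (pB - pD * (q ^+ i.+1)%:MP) _ wr) => [|v]; rewrite !mE //.
  by rewrite ?wbr ?wdr mul0r subr0 oner_neq0.
have h8 : generic (fun v => forall i j, pD.@[tnth v] * q * q ^+ j
    - pA.@[tnth v] * pB.@[tnth v] * q ^+ i != 0).
  apply: generic_all => i; apply: generic_all => j.
  apply: (@generic_neq0 (pD * q%:MP * (q ^+ j)%:MP - pA * pB * (q ^+ i)%:MP) _ wq) => [|v]; rewrite !mE //.
  by rewrite ?waq ?wbq ?wdq mulr0 mul0r subr0 mul1r mulf_neq0.
have h9 : generic (fun v => forall i, pC.@[tnth v] * pD.@[tnth v] * q * q ^+ i
    - pA.@[tnth v] * pB.@[tnth v] != 0).
  apply: generic_all => i.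
  apply: (@generic_neq0 (pC * pD * q%:MP * (q ^+ i)%:MP - pA * pB) _ wq) => [|v]; rewrite !mE //.
  by rewrite ?waq ?wbq ?wcq ?wdq mulr0 subr0 !mul1r mulf_neq0.
have := generic_and (generic_and ha (generic_and hb (generic_and hc hd)))
  (generic_and h1 (generic_and h2 (generic_and h3 (generic_and h4
  (generic_and h5 (generic_and h6 (generic_and h7 (generic_and h8 h9)))))))).
apply: generic_sub => v [[? [? [? ?]]] [? [? [? [? [? [? [? [? ?]]]]]]]]].
by constructor.
Qed.

End Generic.

Theorem theorem1 (K : numFieldType) (cs : racah_case K) (hcs : valid_case cs) :
  (* a, b, c, d generic *)
  generic (fun v : 4.-tuple K =>
    let l := Params v`_0 v`_1 v`_2 v`_3 in
    forall (M : nat) (D : M.-tuple nat) (n : nat),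
      (1 <= M)%N -> sorted ltn D -> all (leq 1) D ->
      recurrence_norm cs l D n /\ recurrence_energy cs l D n)
  /\
  (* a = -N, resp. q^-N, and b, c, d generic *)
  (forall N : nat, (1 <= N)%N ->
   generic (fun v : 3.-tuple K =>
    let l := Params (trunc_a cs N) v`_0 v`_1 v`_2 in
    forall (M : nat) (D : M.-tuple nat) (n : nat),
      (1 <= M)%N -> sorted ltn D -> all (leq 1) D ->
      (n + M + 1 <= N)%N ->
      recurrence_norm cs l D n /\ recurrence_energy cs l D n)).
Proof.
split=> [|N _].
  pose X (i : nat) : {mpoly K[4]} := 'X_(inord i).
  have XE (v : 4.-tuple K) i : (i < 4)%N -> (X i).@[tnth v] = v`_i.
    by move=> i4; rewrite mevalXU (tnth_nth 0) inordK.
  have wit a b c d : exists w : 'I_4 -> K,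
      [/\ (X 0%N).@[w] = a, (X 1%N).@[w] = b, (X 2%N).@[w] = c & (X 3%N).@[w] = d].
    by exists (tnth [tuple a; b; c; d]); split; rewrite XE.
  (* With a free, n + M + 1 is unbounded, so all [B] are imposed at once; they are countably
     many. *)
  suff : generic (fun v => forall B, good cs (Params (X 0%N).@[tnth v]
      (X 1%N).@[tnth v] (X 2%N).@[tnth v] (X 3%N).@[tnth v]) B).
    apply: generic_sub => v; rewrite !XE // => g /= M D n _ sD _.
    have {}g := g (n + M + 1)%N.
    by split; [apply: recurrence_normP g sD _ | apply: recurrence_energyP g sD _].
  apply: generic_all => B; case: cs hcs => [|q] v.
    apply: (@generic_good_racah _ _ _ _ _ _ 0 (wit 0)) => i _.
    have [w [wa _ _ _]] := wit (1 - i%:R) 0 0 0.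
    by exists w; rewrite wa subrK oner_neq0.
  apply: (@generic_good_qracah _ _ _ _ _ _ 1 (wit 1)) => //; first exact: oner_neq0.
  move=> i _; have [w [wa _ _ _]] := wit 0 0 0 0.
  by exists w; rewrite wa mul0r subr0 oner_neq0.
pose X (i : nat) : {mpoly K[3]} := 'X_(inord i).
have XE (v : 3.-tuple K) i : (i < 3)%N -> (X i).@[tnth v] = v`_i.
  by move=> i3; rewrite mevalXU (tnth_nth 0) inordK.
pose A : {mpoly K[3]} := (trunc_a cs N)%:MP.
have wit b c d : exists w : 'I_3 -> K,
    [/\ A.@[w] = trunc_a cs N, (X 0%N).@[w] = b, (X 1%N).@[w] = c & (X 2%N).@[w] = d].
  by exists (tnth [tuple b; c; d]); split; rewrite ?XE ?mevalC.
(* For i in nat, a = -N satisfies a + i != 0 as long as i < N, so [B] is N; likewise for q^-N. *)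
suff : generic (fun v => good cs (Params A.@[tnth v]
    (X 0%N).@[tnth v] (X 1%N).@[tnth v] (X 2%N).@[tnth v]) N).
  apply: generic_sub => v; rewrite !XE // mevalC => g /= M D n _ sD _ nN.
  by split; [apply: recurrence_normP g sD nN | apply: recurrence_energyP g sD nN].
move: @A wit; case: cs hcs => [|q] v A wit.
  apply: (generic_good_racah wit) => i iN; exists (fun=> 0).
  by rewrite mevalC addrC subr_eq0 eqr_nat ltn_eqF.
have q0 := qcase_neq0 v.
apply: (generic_good_qracah wit v) => [|i iN]; first by rewrite invr_eq0 expf_neq0.
exists (fun=> 0); rewrite mevalC /=.
have -> : q ^+ N = q ^+ (N - i) * q ^+ i by rewrite -exprD subnK // ltnW.
have qi : q ^+ i != 0 by rewrite expf_neq0.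
have qNi : q ^+ (N - i) != 0 by rewrite expf_neq0.
have -> : 1 - (q ^+ (N - i) * q ^+ i)^-1 * q ^+ i
  = - (1 - q ^+ (N - i)) / q ^+ (N - i) by field; rewrite qi qNi.
by rewrite mulf_neq0 ?invr_eq0 // oppr_eq0 qpow_neq1 // subn_gt0.
Qed.
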